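(* Let $\mathcal S$ be an aperiodic $\mathbf q$-substitution on $\mathcal A$ which is bijective (every instruction $\mathcal R_{\mathbf j}$, $\mathbf j\in[\mathbf 0,\mathbf q)$, is a bijection of $\mathcal A$) and commutative ($\mathcal R_{\mathbf i}\mathcal R_{\mathbf j}=\mathcal R_{\mathbf j}\mathcal R_{\mathbf i}$ for all $\mathbf i,\mathbf j\in[\mathbf 0,\mathbf q)$). Then $\mathcal S$ has purely singular spectrum: $\sigma_{\max}$ is singular with respect to Lebesgue measure on $\mathbb T^d$.
   Context: Conventions: fix $d\ge1$; operations and inequalities on $\mathbb Z^d$ are coordinatewise, $[\mathbf a,\mathbf b)=\{\mathbf j:a_i\le j_i<b_i\}$. Fix $\mathbf q\in\mathbb Z^d$ with all $q_i\ge2$. For $\mathbf k\in\mathbb Z^d$, $\lceil\mathbf k\rceil_1\in[\mathbf 0,\mathbf q)$ and $\lfloor\mathbf k\rfloor_1\in\mathbb Z^d$ are the unique elements with $\mathbf k=\lceil\mathbf k\rceil_1+\lfloor\mathbf k\rfloor_1\mathbf q$. Substitutions: $\mathcal A$ is a finite alphabet with at least two letters; $\mathcal A^{\mathbb Z^d}$ has the product topology and the shift $(T^{\mathbf k}A)(\mathbf j)=A(\mathbf j+\mathbf k)$. A block is a map from a finite subset of $\mathbb Z^d$ to $\mathcal A$. A $\mathbf q$-substitution $\mathcal S$ assigns to each letter $\gamma$ a block $\mathcal S(\gamma):[\mathbf 0,\mathbf q)\to\mathcal A$; it extends to blocks and sequences by $(\mathcal S\omega)(\mathbf j)=\mathcal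 S(\omega(\lfloor\mathbf j\rfloor_1))(\lceil\mathbf j\rceil_1)$. Its instructions are the maps $\mathcal R_{\mathbf j}:\mathcal A\to\mathcal A$, $\gamma\mapsto\mathcal S(\gamma)(\mathbf j)$. $X_{\mathcal S}$ is the set of sequences all of whose finite sub-blocks occur, up to translation, as sub-blocks of some $\mathcal S^n(\gamma)$, $n\in\mathbb N$, $\gamma\in\mathcal A$. $\mathcal S$ is aperiodic if $T^{\mathbf k}A=A$ with $A\in X_{\mathcal S}$ implies $\mathbf k=\mathbf 0$. Spectrum: for a $T$-invariant Borel probability measure $\mu$ on $X_{\mathcal S}$ and $f\in L^2(\mu)$, $\sigma_f$ is the positive measure on the torus $\mathbb T^d$ with $\int z_1^{-k_1}\cdots z_d^{-k_d}\,d\sigma_f=\int f\circ T^{-\mathbf k}\,\overline f\,d\mu$ for $\mathbf k\in\mathbb Z^d$. The maximal spectral type $\sigma_{\max}(\mu)$ is the type (mutual absolute continuity class) of $\sigma_F$ for $F\in L^2(\mu)$ such that $\sigma_f\ll\sigma_F$ for all $f\in L^2(\mu)$. The spectrum of $\mathcal S$ is $\sigma_{\max}=\sum_\mu\sigma_{\max}(\mu)$, the sum over the (finitely many) ergodic $T$-invariant probability measures of $X_{\mathcal S}$; it is defined up to equivalence of measures. *)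

(* Defs.v *)
From HB Require Import structures.
From mathcomp Require Import all_boot all_order all_algebra.
From mathcomp Require Import complex.
From mathcomp Require Import all_classical all_reals all_analysis.
From mathcomp Require Import measurable_realfun.

Set Implicit Arguments.
Unset Strict Implicit.
Unset Printing Implicit Defensive.

Import Order.TTheory GRing.Theory Num.Theory.
Import numFieldNormedType.Exports.

Local Open Scope classical_set_scope.
Local Open Scope ring_scope.

Section lattice.
Variable d : nat.
Implicit Types a b j k m q r : 'rV[int]_d.

Definition cmul a b : 'rV[int]_d := \row_i (a 0 i * b 0 i).

Definition box a b : set 'rV[int]_d :=
  [set j | forall i, a 0 i <= j 0 i < b 0 i].

(* $\lceil k\rceil_1$ (remainder) and $\lfloor k\rfloor_1$ (quotient), by
   Euclidean division in each coordinate; [crem_box], [crem_cquoE] and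
   [crem_cquo_unique] give their defining property. *)
Definition crem q k : 'rV[int]_d := \row_i modz (k 0 i) (q 0 i).
Definition cquo q k : 'rV[int]_d := \row_i divz (k 0 i) (q 0 i).

Lemma crem_box q k : (forall i, 2 <= q 0 i) -> box 0 q (crem q k).
Proof.
move=> hq i; have q0 : 0 < q 0 i by apply: lt_le_trans (hq i).
by rewrite !mxE modz_ge0 ?gt_eqF// ltz_pmod.
Qed.

Lemma crem_cquoE q k : k = crem q k + cmul (cquo q k) q.
Proof. by apply/rowP => i; rewrite !mxE addrC -divz_eq. Qed.

Lemma crem_cquo_unique q k r m : box 0 q r -> k = r + cmul m q ->
  r = crem q k /\ m = cquo q k.
Proof.
move=> rq ->; split; apply/rowP => i; rewrite !mxE;
  have := rq i; rewrite mxE => /andP[r0 rqi].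
- by rewrite addrC modzMDl modz_small// r0 (lt_le_trans rqi)// ler_norm.
- rewrite addrC divzMDl ?gt_eqF ?(le_lt_trans r0)// divz_small ?addr0//.
  by rewrite r0 (lt_le_trans rqi)// ler_norm.
Qed.

End lattice.

(* The pointed structure on the alphabet is only there because the measurable
   types of the library are pointed. *)
Definition fullshift (d : nat) (A : pointedType) :=
  prod_topology (fun _ : 'rV[int]_d => discrete_topology A).
Definition config (d : nat) (A : pointedType) :=
  g_sigma_algebraType (@open (fullshift d A)).
HB.instance Definition _ d A := Measurable.on (config d A).

Section substitution.
Variables (d : nat) (A : pointedType).
Implicit Types (q j k : 'rV[int]_d) (x : config d A).

Definition shift k x : config d A := fun j => x (j + k).

(* [S c j] is the letter of the block $\mathcal S(c)$ at position [j]; only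
   its values at positions [j] in [box 0 q] are ever used. *)
Definition substitution := A -> 'rV[int]_d -> A.

Definition instruction (S : substitution) j : A -> A := fun c => S c j.

(* A block is a partial map, with value [None] off its (finite) domain. *)
Definition block := 'rV[int]_d -> option A.

Definition letter (c : A) : block := fun j => if j == 0 then Some c else None.

Definition subst_block q (S : substitution) (w : block) : block :=
  fun j => omap (fun c => S c (crem q j)) (w (cquo q j)).

Definition subst_power q S n (c : A) : block :=
  iter n (subst_block q S) (letter c).

Definition subst_shift q S : set (config d A) :=
  [set x | forall D : set 'rV[int]_d, finite_set D ->
     exists n c k, forall j, D j -> subst_power q S n c (j + k) = Some (x j)].

Definition aperiodic q S :=
  forall x k, subst_shift q S x -> shift k x = x -> k = 0.

Definition bijective_subst q S :=
  forall j, box 0 q j -> bijective (instruction S j).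

Definition commutative_subst q S :=
  forall i j, box 0 q i -> box 0 q j ->
  instruction S i \o instruction S j = instruction S j \o instruction S i.

End substitution.

Definition cintegral d (T : measurableType d) (R : realType)
    (m : {measure set T -> \bar R}) (g : T -> R[i]) : R[i] :=
  Complex (\int[m]_x complex.Re (g x)) (\int[m]_x complex.Im (g x)).

Definition circle (R : realType) := {z : R[i] | `|z| == 1}.

Section circle.
Variable R : realType.

Lemma circle1 : `|1 : R[i]| == 1. Proof. by rewrite normr1. Qed.

HB.instance Definition _ := SubChoice.on (circle R).
HB.instance Definition _ := isPointed.Build (circle R) (exist _ 1 circle1).

Definition circle_coords (z : circle R) : R * R :=
  (complex.Re (val z), complex.Im (val z)).

(* Borel sets: traces of the Borel sets of the plane. *)
HB.instance Definition _ :=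
  Measurable.copy (circle R)
    (@g_sigma_algebra_preimageType _ (circle R) (R * R)%type circle_coords).

Lemma expi_norm (t : R) : `|Complex (cos t) (sin t)| == 1.
Proof. by rewrite normc_def /= cos2Dsin2 sqrtr1. Qed.

Definition expi (t : R) : circle R :=
  exist _ (Complex (cos t) (sin t)) (expi_norm t).

Definition circle_param (t : measurableTypeR R) : circle R := expi (2 * pi * t).

Lemma measurable_circle_param : measurable_fun setT circle_param.
Proof.
have mpi : measurable_fun [set: R] (fun t : R => 2 * pi * t).
  exact: mulrl_measurable.
move=> _ B [C mC <-]; rewrite !setTI.
have mp : measurable_fun [set: R] (circle_coords \o circle_param).
  apply/measurable_fun_pairP; split.
  - apply: (@measurableT_comp _ _ _ _ _ _ (@cos R)) => //.
    by apply: continuous_measurable_fun; exact: continuous_cos.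
  - apply: (@measurableT_comp _ _ _ _ _ _ (@sin R)) => //.
    by apply: continuous_measurable_fun; exact: continuous_sin.
by have := mp measurableT _ mC; rewrite setTI.
Qed.

HB.instance Definition _ := isMeasurableFun.Build _ _ _ _ circle_param
  measurable_circle_param.

(* Lebesgue measure of the circle: the law of $e^{2\pi it}$ for $t$ uniformly
   distributed in $[0, 1]$. *)
Definition circle_lebesgue : probability (circle R) R :=
  distribution (uniform_prob (@ltr01 R)) circle_param.

End circle.

(* $\mathbb T^d$; the measurable structure on tuples is the product one, which
   here is the Borel one. *)
Definition torus (R : realType) (d : nat) := d.-tuple (circle R).
HB.instance Definition _ (R : realType) d := Measurable.on (torus R d).

Section torus.
Variable R : realType.

Definition torus_cons d (zw : circle R * torus R d) : torus R d.+1 :=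
  [tuple of zw.1 :: zw.2].

Lemma measurable_torus_cons d :
  measurable_fun [set: circle R * torus R d] (@torus_cons d).
Proof. exact: measurable_cons. Qed.

HB.instance Definition _ d := isMeasurableFun.Build _ _ _ _ (@torus_cons d)
  (@measurable_torus_cons d).

Section product.
Variables (d : nat) (m : probability (torus R d) R).

Definition circle_product : set (circle R * torus R d) -> \bar R :=
  (circle_lebesgue R \x m)%E.

HB.instance Definition _ := Measure.on circle_product.

Let circle_productT : circle_product setT = 1%E.
Proof.
have -> : circle_product setT = (circle_lebesgue R setT * m setT)%E.
  by rewrite -setXTT; exact: product_measure1E.
by rewrite (probability_setT (circle_lebesgue R)) (probability_setT m) mule1.
Qed.

HB.instance Definition _ :=
  Measure_isProbability.Build _ _ _ circle_product circle_productT.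

End product.

(* Lebesgue measure on $\mathbb T^d$: the [d]-fold product of
   [circle_lebesgue]. *)
Fixpoint torus_lebesgue d : probability (torus R d) R :=
  if d is d'.+1 then distribution (circle_product (torus_lebesgue d'))
                                  (@torus_cons d')
  else \d_([tuple] : torus R 0).

Definition torus_char d (k : 'rV[int]_d) (z : torus R d) : R[i] :=
  \prod_(i < d) val (tnth z i) ^ k 0 i.

End torus.

Definition same_type d (T : measurableType d) (R : realType)
    (m1 m2 : set T -> \bar R) := m1 `<< m2 /\ m2 `<< m1.

Definition mutually_singular d (T : measurableType d) (R : realType)
    (m1 m2 : set T -> \bar R) :=
  exists N, [/\ measurable N, m1 N = 0%E & m2 (~` N) = 0%E].

Section spectrum.
Variables (R : realType) (d : nat) (A : pointedType).
Implicit Types (mu : probability (config d A) R).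
Implicit Types (s : {finite_measure set (torus R d) -> \bar R}).

Definition invariant_measure mu := forall k B, measurable B ->
  mu (shift k @^-1` B) = mu B.

Definition ergodic mu := invariant_measure mu /\
  forall B, measurable B -> (forall k, shift k @^-1` B = B) ->
    mu B = 0%E \/ mu B = 1%E.

(* An invariant probability measure on $X_{\mathcal S}$ is seen as one on the
   full shift that gives mass 1 to the closed set $X_{\mathcal S}$. *)
Definition subst_ergodic q (S : substitution d A) mu :=
  ergodic mu /\ mu (subst_shift q S) = 1%E.

Definition square_integrable mu (f : config d A -> R[i]) :=
  [/\ measurable_fun setT (fun x => complex.Re (f x)),
      measurable_fun setT (fun x => complex.Im (f x)) &
      (\int[mu]_x (complex.Re (f x) ^+ 2 + complex.Im (f x) ^+ 2)%:E < +oo)%E].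

(* [s] is $\sigma_f$. *)
Definition spectral_measure mu (f : config d A -> R[i]) s :=
  forall k, cintegral s (torus_char (- k)) =
    cintegral mu (fun x => f (shift (- k) x) * (f x)^* ).

(* [s] represents the type $\sigma_{\max}(\mu)$. *)
Definition max_spectral_type mu s := exists F sF,
  [/\ square_integrable mu F, spectral_measure mu F sF,
      forall f sf, square_integrable mu f -> spectral_measure mu f sf ->
        sf `<< sF &
      same_type s sF].

(* [s] represents the spectrum of [S]: [mu] lists the ergodic measures of the
   subshift, and [t] their maximal spectral types. *)
Definition spectrum q (S : substitution d A) s :=
  exists n (mu : 'I_n -> probability (config d A) R)
    (t : 'I_n -> {finite_measure set (torus R d) -> \bar R}),
  [/\ forall i, subst_ergodic q S (mu i),
      forall i j, (forall B, measurable B -> mu i B = mu j B) -> i = j,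
      forall nu, subst_ergodic q S nu ->
        exists i, forall B, measurable B -> nu B = mu i B,
      forall i, max_spectral_type (mu i) (t i) &
      same_type s (fun B => \sum_(i < n) t i B)%E].

Definition purely_singular q S :=
  forall s, spectrum q S s -> mutually_singular s (torus_lebesgue R d).

End spectrum.

(* Main.v *)
(* Let Q be the product of the q_i. Since the instructions are commuting
   bijections, the letter of S^n(c) at t is obtained from c by a product, taken
   in an abelian group, of one factor for each digit of t. Changing one digit
   multiplies it by a fixed element, and adding q^n m at the n-th digit only
   changes that digit and propagates a carry. Averaging over many n makes the
   digits independent of the carries, and gives, for F in L^2(mu),
     int F^2 <= 12 Q^2 sum_r int |p_r F|^2 + e,
   where p_r F is an average of N translates of F by distinct vectors.
   In spectral terms, let h = sum_r |p_r|^2, a trigonometric polynomial with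
   0 <= h <= Q whose Lebesgue integral is Q / N. Applied to w(T) F, the
   inequality says that the integral of w^2 against sigma_F is at most
   12 Q^2 times that of h w^2, up to e. Hence replacing w by w (1 - h / Q)
   decreases the integral of w^2 by a fixed factor, while it hardly changes the
   Lebesgue integral of 1 - w. Iterating from w = 1 yields polynomials with
   values in [0, 1] which tend to 0 in L^2(sigma_F) and to 1 in L^1(Leb), so
   that sigma_F is singular. *)

From HB Require Import structures.
Require Import Defs.
From mathcomp Require Import all_boot all_order all_algebra all_fingroup.
From mathcomp Require Import complex ring lra zify.
From mathcomp Require Import all_classical all_reals all_analysis.
From mathcomp Require Import measurable_realfun.

Set Implicit Arguments.
Unset Strict Implicit.
Unset Printing Implicit Defensive.

Import Order.TTheory GRing.Theory Num.Theory.
Import numFieldNormedType.Exports HBNNSimple.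

Local Open Scope classical_set_scope.
Local Open Scope ring_scope.

(** * Digits and averages over boxes *)

Section average.
Variable R : realFieldType.

(** The obstacle is that the letter at a point depends on all its digits, the low ones included, so
    that nothing decorrelates by itself. Commutativity removes it: changing a digit has the same
    effect on the group element wherever the digit stands, so a long run of digits offers many
    equivalent places for one change, and mean squares hardly notice it. The vector [qmax], with
    entries q_i - 1, is used because adding it to a digit r carries unless r = 0. The average of the
    translates by [qmax] at the indices n in [N, 2N) thus splits, up to a small fluctuation, into Q
    equal shares indexed by r. The share r = 0 has no carry, so it does not depend on n and is the
    original function up to a digit change; each other share is, up to a digit change, an average of
    translates by pure carries. Solving for the share r = 0 bounds the function by averages alone.
    This is done on blocks, uniformly in the block, hence holds for every invariant probability on
    the subshift. The constant 12 is 3, from a sum of three squares, times 4, from passing twice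
    between F and a local function. *)

Definition avg (T : Type) (s : seq T) (h : T -> R) : R :=
  (size s)%:R^-1 * \sum_(t <- s) h t.

Lemma eq_avg (T : eqType) (s : seq T) (f g : T -> R) :
  {in s, f =1 g} -> avg s f = avg s g.
Proof. by move=> fg; congr (_ * _); apply: eq_big_seq. Qed.

Lemma avgD (T : Type) (s : seq T) (f g : T -> R) :
  avg s (fun t => f t + g t) = avg s f + avg s g.
Proof. by rewrite /avg big_split mulrDr. Qed.

Lemma avgZ (T : Type) (s : seq T) (a : R) (f : T -> R) :
  avg s (fun t => a * f t) = a * avg s f.
Proof. by rewrite /avg -mulr_sumr mulrCA. Qed.

Lemma avgB (T : Type) (s : seq T) (f g : T -> R) :
  avg s (fun t => f t - g t) = avg s f - avg s g.
Proof. by rewrite /avg sumrB mulrBr. Qed.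

Lemma avg_sum (T I : Type) (s : seq T) (r : seq I) (P : pred I) (f : I -> T -> R) :
  avg s (fun t => \sum_(i <- r | P i) f i t) = \sum_(i <- r | P i) avg s (f i).
Proof. by rewrite /avg exchange_big mulr_sumr. Qed.

Lemma exchange_avg (T U : Type) (s : seq T) (u : seq U) (f : T -> U -> R) :
  avg s (fun x => avg u (f x)) = avg u (fun y => avg s (f^~ y)).
Proof.
by rewrite /avg -!mulr_sumr exchange_big /= mulrCA.
Qed.

Lemma ler_avg (T : eqType) (s : seq T) (f g : T -> R) :
  {in s, forall t, f t <= g t} -> avg s f <= avg s g.
Proof.
move=> fg; rewrite ler_wpM2l ?invr_ge0//.
by rewrite big_seq [leRHS]big_seq; apply: ler_sum => i /fg.
Qed.

Lemma avg_ge0 (T : eqType) (s : seq T) (f : T -> R) :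
  {in s, forall t, 0 <= f t} -> 0 <= avg s f.
Proof.
move=> f0; rewrite mulr_ge0 ?invr_ge0// big_seq.
by apply: sumr_ge0 => i /f0.
Qed.

Lemma avg_const (T : Type) (s : seq T) (c : R) :
  (0 < size s)%N -> avg s (fun=> c) = c.
Proof.
move=> s0; rewrite /avg big_const_seq count_predT iter_addr_0 -[c *+ _]mulr_natl.
by rewrite mulKf// pnatr_eq0 -lt0n.
Qed.

Lemma ler_norm_avg (T : eqType) (s : seq T) (f : T -> R) :
  `|avg s f| <= avg s (fun t => `|f t|).
Proof.
rewrite /avg normrM ger0_norm ?invr_ge0//.
by rewrite ler_wpM2l ?invr_ge0//; apply: ler_norm_sum.
Qed.

Lemma avg_map (T U : Type) (s : seq T) (g : T -> U) (f : U -> R) :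
  avg (map g s) f = avg s (f \o g).
Proof. by rewrite /avg size_map big_map. Qed.

Lemma perm_avg (T : eqType) (s t : seq T) (f : T -> R) :
  perm_eq s t -> avg s f = avg t f.
Proof. by move=> st; rewrite /avg (perm_size st) (perm_big _ st). Qed.

Lemma sqr_avg_le (T : eqType) (s : seq T) (f : T -> R) :
  avg s f ^+ 2 <= avg s (fun t => f t ^+ 2).
Proof.
have [s0|s0] := posnP (size s).
  by rewrite /avg s0 invr0 !mul0r expr0n.
have : 0 <= avg s (fun t => (f t - avg s f) ^+ 2).
  by apply: avg_ge0 => t _; exact: sqr_ge0.
rewrite (@eq_avg _ s _
  (fun t => f t ^+ 2 - (2 * avg s f) * f t + avg s f ^+ 2)); last first.
  by move=> t _; ring.
by rewrite avgD avgB (avg_const _ s0) avgZ; lra.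
Qed.

Lemma sqr_sum_le (T : eqType) (s : seq T) (f : T -> R) :
  (\sum_(t <- s) f t) ^+ 2 <= (size s)%:R * \sum_(t <- s) f t ^+ 2.
Proof.
have [s0|s0] := posnP (size s).
  by rewrite (size0nil s0) !big_nil expr0n mul0r.
have n0 : 0 < (size s)%:R :> R by rewrite ltr0n.
have := sqr_avg_le s f; rewrite /avg exprMn.
rewrite -(ler_pM2l (exprn_gt0 2 n0)) mulrA -exprMn mulfV ?gt_eqF// expr1n mul1r.
by rewrite expr2 mulrA mulfK ?gt_eqF.
Qed.

End average.

Section digits.
Variables (d : nat) (q : 'rV[int]_d).
Hypothesis q_ge2 : forall i, 2 <= q 0 i.
Implicit Types (t u m r j : 'rV[int]_d).

Local Notation rem := (crem q).
Local Notation quo := (cquo q).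

Lemma q_gt0 i : 0 < q 0 i. Proof. exact: lt_le_trans (q_ge2 i). Qed.
Lemma q_neq0 i : q 0 i != 0. Proof. by rewrite gt_eqF// q_gt0. Qed.

Definition scale n m : 'rV[int]_d := \row_i (m 0 i * q 0 i ^+ n).

Lemma scale0 m : scale 0 m = m.
Proof. by apply/rowP => i; rewrite mxE expr0 mulr1. Qed.

Lemma scaleD a b m : scale (a + b) m = scale a (scale b m).
Proof. by apply/rowP => i; rewrite !mxE exprD [q 0 i ^+ a * _]mulrC mulrA. Qed.

Lemma scale1 m : scale 1 m = cmul m q.
Proof. by apply/rowP => i; rewrite !mxE expr1. Qed.

Lemma scaleS n m : scale n.+1 m = cmul (scale n m) q.
Proof. by rewrite -scale1 -scaleD add1n. Qed.

Lemma scale_add n m m' : scale n (m + m') = scale n m + scale n m'.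
Proof. by apply/rowP => i; rewrite !mxE mulrDl. Qed.

Lemma scaleN n m : scale n (- m) = - scale n m.
Proof. by apply/rowP => i; rewrite !mxE mulNr. Qed.

Lemma scale_0 n : scale n 0 = 0.
Proof. by apply/rowP => i; rewrite !mxE mul0r. Qed.

Lemma scale_inj n : injective (scale n).
Proof.
move=> m m' /rowP e; apply/rowP => i; have := e i; rewrite !mxE.
by apply: mulIf; rewrite expf_neq0 ?q_neq0.
Qed.

Lemma remq_cquo t : rem t + cmul (quo t) q = t.
Proof. by rewrite -crem_cquoE. Qed.

Lemma quo_addM t m : quo (t + cmul m q) = quo t + m.
Proof. by apply/rowP => i; rewrite !mxE divzDr ?dvdz_mull// mulzK ?q_neq0. Qed.

Lemma rem_addM t m : rem (t + cmul m q) = rem t.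
Proof. by apply/rowP => i; rewrite !mxE addrC modzMDl. Qed.

Lemma rem_small r : box 0 q r -> rem r = r.
Proof.
move=> br; have e : r = r + cmul 0 q.
  by apply/rowP => i; rewrite !mxE mul0r addr0.
by have [<-] := crem_cquo_unique br e.
Qed.

Lemma quo_small r : box 0 q r -> quo r = 0.
Proof.
move=> br; have e : r = r + cmul 0 q.
  by apply/rowP => i; rewrite !mxE mul0r addr0.
by have [_ <-] := crem_cquo_unique br e.
Qed.

Lemma rem_box t : box 0 q (rem t). Proof. exact: crem_box. Qed.

Lemma rem_addr t u : rem (rem t + u) = rem (t + u).
Proof. by rewrite -{2}(remq_cquo t) addrAC rem_addM. Qed.

Lemma quo_addr t u : quo (t + u) = quo t + quo (rem t + u).
Proof. by rewrite -{1}(remq_cquo t) addrAC quo_addM; exact: addrC. Qed.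

Lemma iter_quo_scale l n t m : (l <= n)%N ->
  iter l quo (t + scale n m) = iter l quo t + scale (n - l) m.
Proof.
elim: l n t => [|l IH] n t; first by rewrite subn0.
case: n => // n ln; by rewrite !iterSr scaleS quo_addM IH.
Qed.

Lemma rem_iter_quo_scale l n t m : (l < n)%N ->
  rem (iter l quo (t + scale n m)) = rem (iter l quo t).
Proof.
move=> ln; rewrite iter_quo_scale ?(ltnW ln)//.
by rewrite -(subnSK ln) scaleS rem_addM.
Qed.

(** Replaces the digit of index i by r: the correction is a multiple of q^i and, when r is a digit,
    creates no carry. *)
Definition setdig i r t := t + scale i (r - rem (iter i quo t)).

Lemma iter_quo_setdig l i r t : box 0 q r -> (i < l)%N ->
  iter l quo (setdig i r t) = iter l quo t.
Proof.
move=> br il; rewrite -(subnK il) !iterD; congr iter.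
rewrite !iterS /setdig iter_quo_scale// subnn scale0.
set v := iter i quo t.
by rewrite quo_addr [rem v + _]addrC subrK (quo_small br) addr0.
Qed.

Lemma rem_iter_quo_setdig i r t : box 0 q r ->
  rem (iter i quo (setdig i r t)) = r.
Proof.
move=> br; rewrite /setdig iter_quo_scale// subnn scale0.
set v := iter i quo t.
by rewrite -rem_addr [rem v + _]addrC subrK rem_small.
Qed.

Lemma box_neq0_ex r : box 0 q r -> r != 0 -> exists i, 0 < r 0 i.
Proof.
move=> br r0; apply: contrapT => nex; case/eqP: r0; apply/rowP => i.
have /andP[ri _] := br i; rewrite mxE in ri; rewrite mxE.
by apply/eqP; rewrite eq_le ri andbT leNgt; apply/negP => h; apply: nex; exists i.
Qed.

Lemma finite_box : finite_set (box 0 q).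
Proof.
pose B := {dffun forall i : 'I_d, 'I_(absz (q 0 i))}.
pose g (f : B) : 'rV[int]_d := \row_i (f i)%:Z.
suff -> : box 0 q = g @` [set: B] by apply: finite_image; exact: finite_finset.
apply/seteqP; split => [r br|_ [f _ <-]].
- have ri i : (absz (r 0%R i) < absz (q 0%R i))%N.
    have := br i; rewrite mxE => /andP[r0 rq].
    by rewrite -ltz_nat !gez0_abs// ?(le_trans r0) ?(ltW rq).
  exists [ffun i => Ordinal (ri i)] => //.
  apply/rowP => i; rewrite !mxE ffunE /= gez0_abs//.
  by have := br i; rewrite mxE => /andP[].
- move=> i; rewrite !mxE lez_nat leq0n /=.
  by rewrite -[X in _ < X]gez0_abs ?(ltW (q_gt0 i))// ltz_nat.
Qed.

Lemma digits_ex : exists s : seq 'rV[int]_d,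
  uniq s /\ forall r, r \in s <-> box 0 q r.
Proof.
have [s Es] := (finite_seqP (box 0 q)).1 finite_box.
exists (undup s); rewrite undup_uniq; split=> // r.
by rewrite mem_undup Es.
Qed.

Definition digits : seq 'rV[int]_d := sval (cid digits_ex).

Lemma digits_uniq : uniq digits. Proof. exact: (svalP (cid digits_ex)).1. Qed.

Lemma digitsP r : reflect (box 0 q r) (r \in digits).
Proof. by apply: (iffP idP) => /(svalP (cid digits_ex)).2. Qed.

Lemma rem_digits t : rem t \in digits.
Proof. by apply/digitsP; exact: rem_box. Qed.

Definition qmax : 'rV[int]_d := \row_i (q 0 i - 1).

Lemma digits0 : 0 \in digits.
Proof. by apply/digitsP => i; rewrite !mxE lexx q_gt0. Qed.

Lemma qmax_digits : qmax \in digits.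
Proof.
apply/digitsP => i; rewrite !mxE; have := q_ge2 i; lia.
Qed.

Lemma size_digits_gt0 : (0 < size digits)%N.
Proof. by have := digits0; case: digits. Qed.

Lemma size_digits_gt1 : (0 < d)%N -> (1 < size digits)%N.
Proof.
move=> d0; have := @uniq_leq_size _ [:: 0; qmax] digits; apply.
  rewrite /= inE andbT; apply/negP => /eqP/rowP/(_ (Ordinal d0)).
  by rewrite !mxE; have := q_ge2 (Ordinal d0); lia.
by move=> r; rewrite !inE => /orP[]/eqP->; [exact: digits0|exact: qmax_digits].
Qed.

Lemma perm_rem_digits j : perm_eq [seq rem (r + j) | r <- digits] digits.
Proof.
have inj : {in digits &, injective (fun r => rem (r + j))}.
  move=> r r' /digitsP br /digitsP br' e.
  have : rem (rem (r + j) - j) = rem (rem (r' + j) - j) by rewrite e.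
  by rewrite !rem_addr !addrK !rem_small.
apply: uniq_perm.
- by rewrite map_inj_in_uniq// digits_uniq.
- exact: digits_uniq.
apply: (uniq_min_size _ _ _).2.
- by rewrite map_inj_in_uniq// digits_uniq.
- by move=> _ /mapP[r _ ->]; exact: rem_digits.
- by rewrite size_map.
Qed.

Fixpoint boxseq n : seq 'rV[int]_d :=
  if n is n'.+1 then [seq r + cmul t q | r <- digits, t <- boxseq n']
  else [:: 0].

Lemma size_boxseq n : size (boxseq n) = (size digits ^ n)%N.
Proof. by elim: n => //= n IH; rewrite size_allpairs IH expnS. Qed.

Lemma size_boxseq_gt0 n : (0 < size (boxseq n))%N.
Proof. by rewrite size_boxseq expn_gt0 size_digits_gt0. Qed.

(** Digit form of membership in [0, q^n): floor division keeps negative coordinates negative, so the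
    iterated quotient vanishes only inside the box. *)
Lemma mem_boxseq n t : (t \in boxseq n) = (iter n quo t == 0).
Proof.
elim: n t => [|n IH] t; first by rewrite inE.
rewrite iterSr -IH; apply/allpairsP/idP => [[[r u] /= [rD uB ->]]|tB].
  by rewrite quo_addM quo_small ?add0r//; exact/digitsP.
by exists (rem t, quo t); rewrite rem_digits/= remq_cquo.
Qed.

Lemma boxseq_uniq n : uniq (boxseq n).
Proof.
elim: n => //= n IH; apply: allpairs_uniq; rewrite ?digits_uniq//.
move=> x y /allpairsP[[r t] /= [/digitsP br _ ->]].
move=> /allpairsP[[r' t'] /= [/digitsP br' _ ->]] /= e.
have := congr1 rem e; have := congr1 quo e.
rewrite !quo_addM !rem_addM (quo_small br) (quo_small br').
by rewrite (rem_small br) (rem_small br') !add0r => -> ->.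
Qed.

(** * Averages over the boxes [0, q^n) *)

Section box_average.
Variable R : realFieldType.
Implicit Types h : 'rV[int]_d -> R.

Lemma avg_boxS n h : avg (boxseq n.+1) h =
  avg digits (fun r => avg (boxseq n) (fun t => h (r + cmul t q))).
Proof.
rewrite /avg [size _]size_allpairs big_allpairs_dep natrM invfM -!mulrA.
by congr (_ * _); rewrite mulr_sumr.
Qed.

Lemma avg_boxD a b h : avg (boxseq (a + b)) h =
  avg (boxseq a) (fun r => avg (boxseq b) (fun t => h (r + scale a t))).
Proof.
elim: a h => [|a IH] h.
  rewrite add0n {2}/boxseq [RHS]/avg /= big_seq1 invr1 mul1r.
  by apply: eq_avg => t _; rewrite scale0 add0r.
rewrite addSn !avg_boxS; apply: eq_avg => r _; rewrite IH.
apply: eq_avg => u _; apply: eq_avg => t _; congr (h _).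
by rewrite -addrA; congr (_ + _); apply/rowP => i; rewrite !mxE exprSr; ring.
Qed.

Definition znorm j : R := \sum_i `|j 0 i|%:~R.

Lemma znorm_ge0 j : 0 <= znorm j.
Proof. by apply: sumr_ge0 => i _; rewrite ler0z. Qed.

Lemma znorm_ge1 j : j != 0 -> 1 <= znorm j.
Proof.
move=> j0; have [i ji] : exists i, j 0 i != 0.
  apply: contrapT => nex; case/eqP: j0; apply/rowP => i; rewrite mxE.
  by apply/eqP; apply: contrapT => /negP h; apply: nex; exists i.
rewrite /znorm (bigD1 i)//= -[leLHS]addr0 lerD//.
  by rewrite ler1z; lia.
by apply: sumr_ge0 => l _; rewrite ler0z.
Qed.

(* The carries produced by adding [j] to a random digit average to [j / q]. *)
Lemma avg_znorm_quo j : avg digits (fun r => znorm (quo (r + j))) <= znorm j / 2.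
Proof.
rewrite /znorm avg_sum mulr_suml; apply: ler_sum => i _.
have qi : 0 < (q 0 i)%:~R :> R by rewrite ltr0z q_gt0.
(* Since r is a digit, a nonzero carry has the sign of j_i. Absolute values can then be averaged as
   signed quantities, and the signed mean is exact because adding j permutes the digits. *)
have E (r : 'rV[int]_d) : r \in digits ->
    `|quo (r + j) 0 i|%:~R = (Num.sg (j 0 i))%:~R * (quo (r + j) 0 i)%:~R :> R.
  move=> /digitsP/(_ i); rewrite -intrM !mxE => /andP[r0 rq].
  congr (_%:~R); have [j0|j0|j0] := sgrP (j 0 i).
  - by rewrite mul0r j0 addr0 divz_small ?normr0// r0 (lt_le_trans rq)// ler_norm.
  - by rewrite mul1r ger0_norm// divz_ge0 ?q_gt0// addr_ge0// ltW.
  - by rewrite mulN1r ler0_norm// -ltzD1 add0r ltz_divLR ?q_gt0// mul1r ltr_wnDr// ltW.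
rewrite (eq_avg E) avgZ.
have -> : avg digits (fun r => (quo (r + j) 0 i)%:~R) =
    (j 0 i)%:~R / (q 0 i)%:~R :> R.
  apply: (mulIf (lt0r_neq0 qi)); rewrite mulfVK ?lt0r_neq0// mulrC -avgZ.
  rewrite (@eq_avg _ _ digits _ (fun r => (r 0 i)%:~R -
    (rem (r + j) 0 i)%:~R + (j 0 i)%:~R)); last first.
    move=> r _; have := congr1 (fun v : 'rV[int]_d => (v 0 i)%:~R : R)
      (remq_cquo (r + j)); rewrite /= mxE [in X in _ + X]mxE intrD intrM.
    by rewrite [in RHS]mxE intrD => ?; lra.
  rewrite avgD avgB avg_const ?size_digits_gt0//.
  rewrite -[X in _ - X](@avg_map _ _ _ _ (fun r => rem (r + j))
    (fun r => (r 0 i)%:~R)).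
  by rewrite (perm_avg _ (perm_rem_digits j)) subrr add0r.
rewrite mulrA -intrM -normrEsg ler_wpM2l ?ler0z// lef_pV2 ?posrE//.
by rewrite -[2]/(2%:Z%:~R) ler_int.
Qed.

(** Peel off the lowest digit: adding j permutes it and hands a carry to the level above. Carries
    have on average at most half the norm of j, whence one factor 1/2 per level. At level 0 the
    trivial bound 2C suffices, a nonzero integer vector having norm at least 1. *)
Lemma avg_box_shift n h (C : R) j : (forall t, `|h t| <= C) ->
  `|avg (boxseq n) (fun t => h (t + j)) - avg (boxseq n) h| <=
  2 * C * znorm j / 2 ^+ n.
Proof.
move=> hC; have C0 : 0 <= C by apply: le_trans (hC 0).
elim: n h hC j => [|n IH] h hC j.
  rewrite /avg expr0 divr1 !big_seq1 invr1 !mul1r.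
  have [->|j0] := eqVneq j 0; first by rewrite addr0 subrr normr0 !mulr_ge0 ?znorm_ge0.
  apply: le_trans (ler_normB _ _) _; have := hC (0 + j); have := hC 0.
  have := znorm_ge1 j0; nra.
have E : avg (boxseq n.+1) h = avg digits (fun r =>
    avg (boxseq n) (fun t => h (rem (r + j) + cmul t q))).
  rewrite avg_boxS -(perm_avg _ (perm_rem_digits j)) avg_map; exact: eq_avg.
rewrite E avg_boxS -avgB; apply: le_trans (ler_norm_avg _ _) _.
have -> : 2 * C * znorm j / 2 ^+ n.+1 = (2 * C / 2 ^+ n) * (znorm j / 2).
  by rewrite exprSr invfM; ring.
apply: le_trans (ler_wpM2l _ (avg_znorm_quo j)); last first.
  by rewrite !mulr_ge0// invr_ge0 exprn_ge0.
rewrite -avgZ; apply: ler_avg => r _.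
rewrite (@eq_avg _ _ _ (fun t => h (r + cmul t q + j))
  (fun t => h (rem (r + j) + cmul (t + quo (r + j)) q))); last first.
  move=> t _; congr h; rewrite addrAC -{1}(remq_cquo (r + j)) -addrA.
  by congr (_ + _); apply/rowP => i; rewrite !mxE; ring.
apply: le_trans (IH (fun t => h (rem (r + j) + cmul t q)) _ _) _ => //.
by rewrite mulrAC.
Qed.

(** The digits of a uniform point of the box are independent and uniform, so one of them may be
    redrawn. *)
Lemma resample i n h : (i < n)%N -> avg (boxseq n) h =
  avg (boxseq n) (fun u => avg digits (fun r => h (setdig i r u))).
Proof.
elim: i n h => [|i IH] [//|n] h in_.
  rewrite !avg_boxS [RHS](@eq_avg _ _ _ _ (fun=> avg (boxseq n) (fun t =>
    avg digits (fun r => h (r + cmul t q))))).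
    by rewrite avg_const ?size_digits_gt0// exchange_avg.
  move=> r0 /digitsP b0; apply: eq_avg => t _; apply: eq_avg => r _.
  by rewrite /setdig /= rem_addM rem_small// scale0 addrC addrA subrK.
rewrite !avg_boxS; apply: eq_avg => r0 /digitsP b0; rewrite (IH n)//.
apply: eq_avg => t _; apply: eq_avg => r _; congr h.
rewrite /setdig scaleS iterSr quo_addM (quo_small b0) add0r -addrA.
by congr (_ + _); apply/rowP => l; rewrite !mxE; ring.
Qed.

Lemma avg_digits_eq r (F : R) : r \in digits ->
  avg digits (fun r' => (r' == r)%:R * F) = (size digits)%:R^-1 * F.
Proof.
move=> rD; rewrite /avg -mulr_suml (bigD1_seq r) ?digits_uniq//= eqxx big1.
  by rewrite addr0 mul1r.
by move=> r' /negPf ->.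
Qed.

(** Redraw the digit of index i on both sides: each indicator becomes an event of probability 1/Q,
    and the remaining factor is in both cases F with that digit set to j. *)
Lemma avg_switch i n r j (F : 'rV[int]_d -> R) : (i < n)%N ->
  r \in digits -> j \in digits ->
  avg (boxseq n) (fun u => (rem (iter i quo u) == r)%:R * F (setdig i j u)) =
  avg (boxseq n) (fun u => (rem (iter i quo u) == j)%:R * F u).
Proof.
move=> in_ rD jD; rewrite (resample _ in_) [RHS](resample _ in_).
apply: eq_avg => u _.
have setK a b : a \in digits -> setdig i b (setdig i a u) = setdig i b u.
  move=> /digitsP ba; rewrite {1}/setdig rem_iter_quo_setdig//.
  by rewrite /setdig -addrA -scale_add [a - _ + _]addrC addrA subrK.
rewrite [LHS](@eq_avg _ _ _ _ (fun r' => (r' == r)%:R * F (setdig i j u))).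
  rewrite avg_digits_eq//.
  rewrite [RHS](@eq_avg _ _ _ _ (fun r' => (r' == j)%:R * F (setdig i j u))).
    by rewrite avg_digits_eq.
  move=> a /digitsP ba; rewrite rem_iter_quo_setdig//.
  by have [->|] := eqVneq a j; rewrite ?mul0r.
by move=> a aD; rewrite setK// rem_iter_quo_setdig//; exact/digitsP.
Qed.

Local Notation Q := ((size digits)%:R : R).

Definition xi r i u : R := (rem (iter i quo u) == r)%:R - Q^-1.

Lemma Q_gt0 : 0 < Q. Proof. by rewrite ltr0n size_digits_gt0. Qed.

Lemma Q_ge1 : 1 <= Q. Proof. by rewrite ler1n size_digits_gt0. Qed.

Lemma invQ_le1 : 0 <= Q^-1 <= 1.
Proof. by rewrite invr_ge0 ltW ?Q_gt0//= invf_le1 ?Q_gt0// Q_ge1. Qed.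

Lemma norm_xi_le1 r i u : `|xi r i u| <= 1.
Proof.
rewrite /xi; have /andP[] := invQ_le1; case: eqP => _ /= *.
  by rewrite ger0_norm; lra.
by rewrite ler0_norm; lra.
Qed.

Lemma avg_xi i n r (Y : 'rV[int]_d -> R) : (i < n)%N -> r \in digits ->
  (forall a u, a \in digits -> Y (setdig i a u) = Y u) ->
  avg (boxseq n) (fun u => xi r i u * Y u) = 0.
Proof.
move=> in_ rD YE; rewrite (resample _ in_).
rewrite -[RHS](@avg_const _ _ (boxseq n) 0 (size_boxseq_gt0 n)).
apply: eq_avg => u _.
rewrite (@eq_avg _ _ _ _ (fun a => (a == r)%:R * Y u - Q^-1 * Y u)).
  by rewrite avgB avg_digits_eq// avg_const ?size_digits_gt0// subrr.
move=> a aD; rewrite YE// /xi rem_iter_quo_setdig; first exact: mulrBl.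
exact/digitsP.
Qed.

(* The terms are orthogonal: the [i]-th one is centred in the [i]-th digit and
   depends on no lower digit. *)
Lemma avg_sqr_xi_sum n r k l (Z : nat -> 'rV[int]_d -> R) :
  (k + l <= n)%N -> r \in digits ->
  (forall i (p : nat) a u, (i <= p)%N -> a \in digits -> Z p (setdig i a u) = Z p u) ->
  (forall p u, `|Z p u| <= 1) ->
  avg (boxseq n) (fun u => (\sum_(k <= m < k + l) xi r m u * Z m u) ^+ 2) <= l%:R.
Proof.
move=> + rD ZE Z1; elim: l k => [|l IH] k kln.
  by rewrite (@eq_avg _ _ _ _ (fun=> 0)) ?avg_const ?size_boxseq_gt0// => u _;
     rewrite addn0 big_geq// expr0n.
pose W u := \sum_(k.+1 <= m < k.+1 + l) xi r m u * Z m u.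
rewrite (@eq_avg _ _ _ _ (fun u => (xi r k u * Z k u) ^+ 2 +
    2 * (xi r k u * (Z k u * W u)) + W u ^+ 2)); last first.
  by move=> u _; rewrite big_ltn ?addnS ?ltnS ?leq_addr// -addSn -/(W u); ring.
(* The cross term vanishes: what multiplies [xi r k u] does not see the digit of index k. *)
rewrite !avgD avgZ avg_xi//; first last.
- move=> a u aD; rewrite ZE//; congr (_ * _); apply: eq_big_nat => m /andP[km _].
  rewrite ZE ?(ltnW km)//; congr (_ * _); rewrite /xi iter_quo_setdig//.
  exact/digitsP.
- by apply: leq_trans kln; rewrite addnS ltnS leq_addr.
rewrite mulr0 addr0 -[l.+1]add1n natrD lerD//; last by rewrite IH// addSnnS.
rewrite -[leRHS](@avg_const _ _ (boxseq n) 1 (size_boxseq_gt0 n)).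
apply: ler_avg => u _; rewrite -real_normK ?num_real// expr_le1// normrM.
by rewrite mulr_ile1// norm_xi_le1.
Qed.

Definition freq r k u : R := k%:R^-1 * \sum_(0 <= i < k) (rem (iter i quo u) == r)%:R.

(** Orthogonality bounds the mean square by 1/K^2, and |x| <= (K/2) x^2 + 1/(2K) turns this into a
    first moment. Taking a square number of digits keeps square roots out of the bounds. *)
Lemma avg_freq n r K : (0 < K)%N -> (K ^ 2 <= n)%N -> r \in digits ->
  avg (boxseq n) (fun u => `|freq r (K ^ 2) u - Q^-1|) <= K%:R^-1.
Proof.
move=> K0 Kn rD; have K0' : 0 < K%:R :> R by rewrite ltr0n.
pose X u := freq r (K ^ 2) u - Q^-1.
have EX u : X u = (K%:R ^+ 2)^-1 * \sum_(0 <= m < 0 + K ^ 2) xi r m u * 1.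
  rewrite /X /freq /xi natrX; under [in RHS]eq_bigr do rewrite mulr1.
  rewrite add0n sumrB big_const_nat iter_addr_0 subn0 mulrBr; congr (_ - _).
  by rewrite -[_^-1 *+ _]mulr_natl natrX mulKf// expf_neq0// gt_eqF.
have X2 : avg (boxseq n) (fun u => X u ^+ 2) <= (K%:R ^+ 2)^-1.
  rewrite (@eq_avg _ _ _ _ (fun u => ((K%:R ^+ 2)^-1) ^+ 2 *
      (\sum_(0 <= m < 0 + K ^ 2) xi r m u * 1) ^+ 2)); last first.
    by move=> u _; rewrite EX exprMn.
  rewrite avgZ.
  have h : avg (boxseq n) (fun u =>
      (\sum_(0 <= m < 0 + K ^ 2) xi r m u * 1) ^+ 2) <= (K ^ 2)%:R.
    by apply: avg_sqr_xi_sum => // _ _; rewrite normr1.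
  apply: le_trans (ler_wpM2l _ h) _; first by rewrite exprn_ge0// invr_ge0 exprn_ge0// ltW.
  by rewrite natrX expr2 mulfVK// expf_neq0// gt_eqF.
apply: (@le_trans _ _ (avg (boxseq n) (fun u => (K%:R / 2) * X u ^+ 2 + (2 * K%:R)^-1))).
  apply: ler_avg => u _; rewrite -/(X u) -[X u ^+ 2]real_normK ?num_real//.
  set x := `|X u|; have : 0 <= (K%:R * x - 1) ^+ 2 by exact: sqr_ge0.
  rewrite -(ler_pM2l K0') => h; rewrite -(ler_pM2l K0').
  have -> : K%:R * (K%:R / 2 * x ^+ 2 + (2 * K%:R)^-1) = (K%:R * x) ^+ 2 / 2 + 1 / 2.
    by field; rewrite gt_eqF.
  have : 0 <= (K%:R * x - 1) ^+ 2 by exact: sqr_ge0.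
  by lra.
rewrite avgD avgZ avg_const ?size_boxseq_gt0//.
apply: le_trans (lerD (ler_wpM2l _ X2) (lexx _)) _; first by rewrite divr_ge0// ltW.
rewrite le_eqVlt; apply/orP; left; apply/eqP; by field; rewrite gt_eqF.
Qed.

(* Among the first [K ^ 2] digits about one in [Q] is [r], and one in [Q] is
   [j]; moving one of the former to [j] transports [F] to [G]. *)
Lemma avg_digit_change n r j K (F G : 'rV[int]_d -> R) :
  (0 < K)%N -> (K ^ 2 <= n)%N -> r \in digits -> j \in digits ->
  (forall u, 0 <= F u <= 1) -> (forall u, 0 <= G u <= 1) ->
  (forall i u, (i < K ^ 2)%N -> rem (iter i quo u) = r -> G u = F (setdig i j u)) ->
  avg (boxseq n) G <= avg (boxseq n) F + 2 * Q / K%:R.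
Proof.
move=> K0 Kn rD jD F01 G01 GF.
have E : avg (boxseq n) (fun u => freq r (K ^ 2) u * G u) =
         avg (boxseq n) (fun u => freq j (K ^ 2) u * F u).
  rewrite /freq; under eq_avg do rewrite -mulrA mulr_suml.
  under [RHS]eq_avg do rewrite -mulrA mulr_suml.
  rewrite !avgZ; congr (_ * _); rewrite !avg_sum; apply: eq_big_nat => i /andP[_ iK].
  rewrite -(@avg_switch i n r j F (leq_trans iK Kn) rD jD).
  apply: eq_avg => u _; case: eqP => [/(GF _ _ iK) ->//|_]; by rewrite !mul0r.
(* Identity [E] is exact; replacing each of the two frequencies by 1/Q costs at most 1/K, as F and G
   lie in [0, 1]. The final multiplication by Q gives 2Q/K. *)
have hr : Q^-1 * avg (boxseq n) G <= avg (boxseq n) (fun u => freq r (K ^ 2) u * G u) + K%:R^-1.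
  rewrite -avgZ -lerBlDl -avgB; apply: le_trans (avg_freq K0 Kn rD).
  apply: ler_avg => u _; have := G01 u; set x := freq _ _ _; set y := G u.
  have := ler_norm (Q^-1 - x); rewrite distrC; have := normr_ge0 (x - Q^-1).
  move: `|_| => a *; nra.
have hj : avg (boxseq n) (fun u => freq j (K ^ 2) u * F u) <= Q^-1 * avg (boxseq n) F + K%:R^-1.
  rewrite -avgZ -lerBlDl -avgB; apply: le_trans (avg_freq K0 Kn jD).
  apply: ler_avg => u _; have := F01 u; set x := freq _ _ _; set y := F u.
  have := ler_norm (x - Q^-1); have := normr_ge0 (x - Q^-1).
  move: `|_| => a *; nra.
have : Q^-1 * avg (boxseq n) G <= Q^-1 * avg (boxseq n) F + 2 * K%:R^-1 by lra.
rewrite -(ler_pM2l Q_gt0) mulrA mulrDr !mulrA divff ?gt_eqF ?Q_gt0// !mul1r.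
by rewrite [Q * 2]mulrC.
Qed.

End box_average.

End digits.

(** * Commuting instructions and carries *)

Section cocycle.
Variables (d : nat) (q : 'rV[int]_d).
Hypothesis q_ge2 : forall i, 2 <= q 0 i.
Variables (gT : finGroupType) (I : 'rV[int]_d -> gT).
Hypothesis commI : forall i j, commute (I i) (I j).
Implicit Types (t u m r j : 'rV[int]_d).

Local Notation rem := (crem q).
Local Notation quo := (cquo q).
Local Notation digits := (digits q_ge2).
Local Notation boxseq := (boxseq q_ge2).

(** In a group of permutations the left factor acts first, so the highest of the n digits acts
    first, as when a substitution is iterated. *)
Fixpoint rho n t : gT :=
  if n is n'.+1 then (rho n' (quo t) * I (rem t))%g else 1%g.

Lemma rho_commI n t j : commute (rho n t) (I j).
Proof.
elim: n t => [|n IH] t /=; first exact: commute_sym (commute1 _).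
by apply: commute_sym; apply: commuteM; [exact: commute_sym|exact: commI].
Qed.

Lemma rho_comm n t k u : commute (rho n t) (rho k u).
Proof.
elim: k u => [|k IH] u /=; first exact: commute1.
by apply: commuteM; [exact: IH|exact: rho_commI].
Qed.

Lemma rho_cat a b t : rho (a + b) t = (rho b (iter a quo t) * rho a t)%g.
Proof.
elim: a t => [|a IH] t; first by rewrite /= mulg1.
by rewrite addSn /= IH -iterSr mulgA.
Qed.

Lemma rho_shift_low a t m : rho a (t + scale q a m) = rho a t.
Proof.
elim: a t => //= a IH t.
by rewrite scaleS quo_addM// rem_addM IH.
Qed.

Lemma rho_shift a b t m :
  rho (a + b) (t + scale q a m) = (rho b (iter a quo t + m) * rho a t)%g.
Proof.
by rewrite rho_cat rho_shift_low iter_quo_scale// subnn scale0.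
Qed.

(** The multiplier is a function of the digits of index at least [a]. This is how the effect of a
    carry becomes independent of the digit that produced it. *)
Lemma rho_shift_mulr a b t m (v := iter a quo t) :
  rho (a + b) (t + scale q a m) =
  (rho (a + b) t * ((rho b v)^-1 * rho b (v + m)))%g.
Proof.
rewrite rho_shift rho_cat mulgA [(rho b v * _)%g]rho_comm mulgK; exact: rho_comm.
Qed.

Lemma commute_swap (x y a b : gT) : commute a x -> commute a y ->
  (a * x * b = x * y^-1 * (a * y * b))%g.
Proof. by move=> -> ->; rewrite -!mulgA mulKg. Qed.

Lemma rho_setdig n i r j t : (i < n)%N -> box 0 q j -> rem (iter i quo t) = r ->
  rho n (setdig q i j t) = (I j * (I r)^-1 * rho n t)%g.
Proof.
move=> in_ bj tr; rewrite -(subnKC in_) addSnnS.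
rewrite [in LHS]/setdig rho_shift rho_cat /=; set v := iter i quo t in tr *.
have -> : v + (j - rem v) = j + cmul (quo v) q.
  by rewrite -{1}(remq_cquo q v) addrC addrA subrK.
rewrite quo_addM// rem_addM (quo_small bj) (rem_small bj) add0r tr.
by apply: commute_swap; exact: rho_commI.
Qed.

(** The two effects of the addition are separated: on the right the digit of index i is still r, and
    the group factor in front performs its change. *)
Lemma rho_carry n i m t (r := rem (iter i quo t)) : (i < n)%N ->
  rho n (t + scale q i m) =
  (I (rem (r + m)) * (I r)^-1 * rho n (t + scale q i.+1 (quo (r + m))))%g.
Proof.
move=> in_; rewrite /r -(subnKC in_) [in RHS]rho_shift addSnnS rho_shift.
have -> : rho i.+1 t = (I (rem (iter i quo t)) * rho i t)%g.
  by rewrite -addn1 rho_cat /= mul1g.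
rewrite /=; set v := iter i quo t.
rewrite quo_addr// -rem_addr//.
by rewrite (commute_swap _ (rho_commI _ _ _) (rho_commI _ _ (rem v))) !mulgA.
Qed.

(* Chosen so that [carry_freq r n] is, up to a change of the digits of index
   at most [n], the effect of adding [scale q n (qmax q)] to a point whose digit
   of index [n] is [r]; only [r = 0] produces no carry. *)
Definition carry_freq r n :=
  if r == 0 then scale q n (qmax q) else scale q n.+1 (quo (r + qmax q)).

Lemma quo_qmax_neq0 r : box 0 q r -> r != 0 -> quo (r + qmax q) != 0.
Proof.
move=> br r0; have [i ri] := box_neq0_ex br r0.
apply/negP => /eqP/rowP/(_ i); rewrite !mxE => h.
have : 1 <= divz (r 0 i + (q 0 i - 1)) (q 0 i).
  by rewrite lez_divRL ?q_gt0// mul1r; move: ri; lia.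
by rewrite h.
Qed.

(** * The energy inequality for functions on the group *)

Section energy.
Variables (R : realFieldType) (phi : gT -> R).
Hypothesis phi1 : forall g, `|phi g| <= 1.

(** Starting at N rather than 0 leaves the digits of index below N free for the changes made by
    [avg_digit_change]. *)
Definition carry_avg N M r u : R :=
  N%:R^-1 * \sum_(N <= n < N + N) phi (rho M (u + carry_freq r n)).

Lemma norm_sum_le1 N (F : nat -> R) : (forall n, `|F n| <= 1) ->
  `|N%:R^-1 * \sum_(N <= n < N + N) F n| <= 1.
Proof.
move=> F1; rewrite normrM ger0_norm ?invr_ge0//.
have [->|N0] := posnP N; first by rewrite invr0 mul0r.
rewrite -(@ler_pM2l _ N%:R) ?ltr0n// mulVKf ?pnatr_eq0 -?lt0n// mulr1.
apply: le_trans (ler_norm_sum _ _ _) _.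
apply: le_trans (ler_sum _ (fun n _ => F1 n)) _.
by rewrite sumr_const_nat addnK.
Qed.

Local Notation Q := ((size digits)%:R : R).

Let psi r (k : nat) u := phi (I (rem (r + qmax q)) * (I r)^-1 * rho k u)%g.

Let B N M r u : R := N%:R^-1 *
  \sum_(N <= n < N + N) psi r M (u + scale q n.+1 (quo (r + qmax q))).

Let D N M r u : R := N%:R^-1 * \sum_(N <= n < N + N) xi q_ge2 R r n u *
  psi r M (u + scale q n.+1 (quo (r + qmax q))).

(** Sort the points by their digit r of index n and write the indicator of each class as 1/Q plus
    [xi]: the constant parts give [B], the centred parts the fluctuation [D]. *)
Let carry_avg0E N M u : (N + N <= M)%N -> carry_avg N M 0 u =
  \sum_(r <- digits) (D N M r u + (size digits)%:R^-1 * B N M r u).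
Proof.
move=> NM; rewrite /D /B; under eq_bigr do rewrite mulrCA -mulrDr.
rewrite -mulr_sumr /carry_avg; congr (_ * _).
under [RHS]eq_bigr do rewrite mulr_sumr -big_split/=.
rewrite exchange_big/=; apply: eq_big_nat => n /andP[_ nN].
under eq_bigr do rewrite -mulrDl /xi subrK.
rewrite (bigD1_seq (rem (iter n quo u))) ?digits_uniq ?rem_digits//= eqxx mul1r.
rewrite big1 ?addr0; last by move=> r; rewrite eq_sym => /negPf ->; rewrite mul0r.
by rewrite /carry_freq eqxx rho_carry// (leq_trans nN).
Qed.

(** [psi] sees every digit, so orthogonality does not apply to [D] directly. Sorting by the value g
    of the carry multiplier helps: the event that it equals g depends only on digits above n, and
    once g is fixed the value of [phi] no longer depends on n and leaves the sum. Cauchy-Schwarz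
    over g costs the square of the order of the group. *)
Let avg_sqr_D N M r : (0 < N)%N -> (N + N <= M)%N -> r \in digits ->
  avg (boxseq M) (fun u => D N M r u ^+ 2) <= #|gT|%:R ^+ 2 / N%:R.
Proof.
move=> N0 NM rD; set e := quo (r + qmax q).
pose Z g n u : R := (((rho (M - n.+1) (iter n.+1 quo u))^-1 *
   rho (M - n.+1) (iter n.+1 quo u + e))%g == g)%:R.
pose S g u := \sum_(N <= n < N + N) xi q_ge2 R r n u * Z g n u.
have S2 g : avg (boxseq M) (fun u => S g u ^+ 2) <= N%:R.
  apply: avg_sqr_xi_sum => // [i n a u in_ /digitsP ba|n u].
    by rewrite /Z iter_quo_setdig.
  by rewrite /Z; case: eqP; rewrite ?normr1 ?normr0.
have DE u : D N M r u = \sum_(g : gT)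
    phi (I (rem (r + qmax q)) * (I r)^-1 * (rho M u * g))%g * (N%:R^-1 * S g u).
  under eq_bigr do rewrite mulrCA; rewrite -mulr_sumr /D; congr (_ * _).
  under [RHS]eq_bigr do rewrite /S mulr_sumr.
  rewrite exchange_big/=; apply: eq_big_nat => n /andP[_ nN].
  set g := ((rho (M - n.+1) (iter n.+1 quo u))^-1 *
    rho (M - n.+1) (iter n.+1 quo u + e))%g.
  rewrite (bigD1 g)//= /Z eqxx mulr1 big1 ?addr0; last first.
    by move=> g'; rewrite eq_sym => /negPf ->; rewrite !mulr0.
  rewrite mulrC; congr (_ * _); rewrite /psi; congr (phi (_ * _)%g).
  by rewrite /g -[M in rho M](subnKC (leq_trans nN NM)) -rho_shift_mulr.
have SN : 0 < N%:R :> R by rewrite ltr0n.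
have D2 u : D N M r u ^+ 2 <= #|gT|%:R * (\sum_(g : gT) (N%:R^-1) ^+ 2 * S g u ^+ 2).
  rewrite DE -!big_enum cardE /=; apply: le_trans (sqr_sum_le _ _) _.
  rewrite ler_wpM2l//; apply: ler_sum => g _.
  rewrite !exprMn -[leRHS]mul1r ler_wpM2r//; first by rewrite -exprMn sqr_ge0.
  by rewrite -real_normK ?num_real// expr_le1.
apply: le_trans (ler_avg (fun u _ => D2 u)) _.
rewrite avgZ avg_sum expr2 -mulrA ler_wpM2l// -sum1_card natr_sum mulr_suml.
apply: ler_sum => g _; rewrite avgZ mul1r.
apply: le_trans (ler_wpM2l _ (S2 g)) _; first by rewrite -expr2 sqr_ge0.
by rewrite mulfVK// gt_eqF.
Qed.

(** A digit change of index below K^2 commutes with a carry entering above n >= K^2. Hence [B] at u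
    is [carry_avg] at u with any one such digit r moved to j, and [avg_digit_change] compares the
    mean squares. *)
Let avg_sqr_B K M r : (0 < K)%N -> (K ^ 2 + K ^ 2 <= M)%N ->
  r \in digits -> r != 0 ->
  avg (boxseq M) (fun u => B (K ^ 2) M r u ^+ 2) <=
  avg (boxseq M) (fun u => carry_avg (K ^ 2) M r u ^+ 2) +
    2 * (size digits)%:R / K%:R.
Proof.
move=> K0 KM rD r0; set j := rem (r + qmax q).
have KM' : (K ^ 2 <= M)%N by apply: leq_trans KM; exact: leq_addr.
have jD : j \in digits by exact: rem_digits.
apply: (@avg_digit_change _ _ _ _ _ r j) => //.
- by move=> u; rewrite sqr_ge0 /= -real_normK ?num_real// expr_le1//; apply: norm_sum_le1 => n; exact: phi1.
- by move=> u; rewrite sqr_ge0 /= -real_normK ?num_real// expr_le1//; apply: norm_sum_le1 => n; exact: phi1.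
move=> i u iK ur; congr (_ ^+ 2); congr (_ * _); apply: eq_big_nat => n /andP[Kn _].
have iN : (i < n.+1)%N by rewrite ltnS (leq_trans (ltnW iK)).
rewrite /carry_freq (negPf r0) /psi; congr phi.
have -> : setdig q i j u + scale q n.+1 (quo (r + qmax q)) =
          setdig q i j (u + scale q n.+1 (quo (r + qmax q))).
  by rewrite /setdig rem_iter_quo_scale// addrAC.
rewrite (@rho_setdig _ _ r)//; first exact: leq_trans KM'.
  exact/digitsP.
by rewrite rem_iter_quo_scale.
Qed.

(* Adding [qmax q] at the digit of index [n] changes it from [r] to
   [rem (r + qmax q)] and carries [quo (r + qmax q)]. Averaging over [n] makes
   the digits independent of the carries, which expresses the value of [phi]
   after a fixed digit change (the term [r = 0]) through the averages
   [carry_avg]; a change of digit hardly affects mean squares. *)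
Lemma energy_bound K M : (0 < K)%N -> (K ^ 2 + K ^ 2 <= M)%N ->
  avg (boxseq M) (fun u => phi (rho M u) ^+ 2) <=
  3 * Q ^+ 2 * \sum_(r <- digits)
    avg (boxseq M) (fun u => carry_avg (K ^ 2) M r u ^+ 2) +
  (2 * Q + 3 * Q ^+ 4 * #|gT|%:R ^+ 2 + 6 * Q ^+ 3) / K%:R.
Proof.
move=> K0 KM; set Q := (size digits)%:R; set N := (K ^ 2)%N in KM *.
have KM' : (K ^ 2 <= M)%N by apply: leq_trans KM; exact: leq_addr.
have N0 : (0 < N)%N by rewrite expn_gt0 K0.
have Q0 : 0 < Q by exact: Q_gt0.
pose g0 := (I (qmax q) * (I 0)^-1)%g.
have rem0 : rem (0 + qmax q) = qmax q.
  by rewrite add0r rem_small//; apply/(digitsP q_ge2); exact: qmax_digits.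
have quo0 : quo (0 + qmax q) = 0.
  by rewrite add0r quo_small//; apply/(digitsP q_ge2); exact: qmax_digits.
(* [g0] is the factor of the change of a digit 0 into [qmax q]; it is undone by turning a digit
   [qmax q] into 0. *)
have step0 : avg (boxseq M) (fun u => phi (rho M u) ^+ 2) <=
    avg (boxseq M) (fun u => phi (g0 * rho M u)%g ^+ 2) + 2 * Q / K%:R.
  apply: (@avg_digit_change _ _ _ _ _ (qmax q) 0) => //.
  - exact: qmax_digits.
  - exact: digits0.
  - by move=> u; rewrite sqr_ge0 /= -real_normK ?num_real// expr_le1.
  - by move=> u; rewrite sqr_ge0 /= -real_normK ?num_real// expr_le1.
  move=> i u iK ur; rewrite (@rho_setdig _ _ (qmax q))//.
  - by rewrite /g0 !mulgA mulgKV mulgV mul1g.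
  - exact: leq_trans KM'.
  - exact/(digitsP q_ge2)/digits0.
pose C := carry_avg N M.
have point u : phi (g0 * rho M u)%g ^+ 2 <= 3 * (Q ^+ 2 * C 0 u ^+ 2 +
    Q ^+ 3 * \sum_(r <- digits) D N M r u ^+ 2 +
    Q * \sum_(r <- digits | r != 0) B N M r u ^+ 2).
  (* For r = 0 nothing is carried, so all the terms averaged in [B] coincide. *)
  have B0 : B N M 0 u = phi (g0 * rho M u)%g.
    rewrite /B quo0; under eq_bigr do rewrite scale_0 addr0 /psi rem0.
    by rewrite sumr_const_nat addnK -[phi _ *+ _]mulr_natl mulKf// pnatr_eq0 -lt0n.
  (* [carry_avg0E] solved for its term [B] of index 0. *)
  have -> : phi (g0 * rho M u)%g = Q * C 0 u - Q * \sum_(r <- digits) D N M r u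
      - \sum_(r <- digits | r != 0) B N M r u.
    rewrite -B0 /C carry_avg0E// -/Q big_split/=.
    have <- : Q^-1 * \sum_(r <- digits) B N M r u = \sum_(r <- digits) Q^-1 * B N M r u.
      exact: mulr_sumr.
    rewrite mulrDr mulVKf ?gt_eqF//.
    by rewrite [\sum_(r <- digits) B N M r u](bigD1_seq 0) ?digits_uniq ?digits0//=; ring.
  have h1 := sqr_sum_le digits (fun r => D N M r u).
  have h2 : (\sum_(r <- digits | r != 0) B N M r u) ^+ 2 <=
      Q * \sum_(r <- digits | r != 0) B N M r u ^+ 2.
    rewrite -[X in X ^+ 2 <= _]big_filter -[X in _ <= _ * X]big_filter.
    apply: le_trans (sqr_sum_le _ _) _.
    rewrite ler_wpM2r ?ler_nat ?size_filter ?count_size//.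
    by apply: sumr_ge0 => r _; exact: sqr_ge0.
  have h3 (a b c : R) : (a - b - c) ^+ 2 <= 3 * (a ^+ 2 + b ^+ 2 + c ^+ 2).
    have := sqr_ge0 (a + b); have := sqr_ge0 (a + c); have := sqr_ge0 (b - c); lra.
  apply: le_trans (h3 _ _ _) _; rewrite ler_pM2l// !exprMn !lerD//.
  by rewrite [Q ^+ 3]exprSr -mulrA ler_pM2l ?exprn_gt0.
apply: le_trans step0 _.
apply: le_trans (lerD (ler_avg (fun u _ => point u)) (lexx _)) _.
rewrite avgZ !avgD !avgZ !avg_sum.
set P0 := avg _ (fun u => C 0 u ^+ 2).
have hD : \sum_(r <- digits) avg (boxseq M) (fun u => D N M r u ^+ 2) <=
    Q * (#|gT|%:R ^+ 2 / K%:R).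
  apply: (@le_trans _ _ (\sum_(r <- digits) #|gT|%:R ^+ 2 / K%:R)).
    rewrite big_seq [leRHS]big_seq; apply: ler_sum => r rD.
    apply: le_trans (avg_sqr_D N0 KM rD) _; rewrite ler_wpM2l ?exprn_ge0//.
    by rewrite lef_pV2 ?posrE ?ltr0n// ler_nat /N -mulnn leq_pmull.
  by rewrite big_const_seq count_predT iter_addr_0 -[leLHS]mulr_natl.
have hB : \sum_(r <- digits | r != 0) avg (boxseq M) (fun u => B N M r u ^+ 2) <=
    \sum_(r <- digits | r != 0) avg (boxseq M) (fun u => C r u ^+ 2)
    + Q * (2 * Q / K%:R).
  apply: (@le_trans _ _ (\sum_(r <- digits | r != 0)
      (avg (boxseq M) (fun u => C r u ^+ 2) + 2 * Q / K%:R))).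
    rewrite big_seq_cond [leRHS]big_seq_cond.
    by apply: ler_sum => r /andP[rD r0]; exact: avg_sqr_B.
  rewrite big_split/= lerD2l big_const_seq iter_addr_0 -[leLHS]mulr_natl.
  rewrite ler_wpM2r ?ler_nat ?count_size// !mulr_ge0 ?invr_ge0//.
rewrite [\sum_(r <- digits) avg _ (fun u => carry_avg N M r u ^+ 2)](bigD1_seq 0) ?digits_uniq ?digits0//= -/P0.
set SB := \sum_(r <- digits | _) _ in hB *; set SD := \sum_(r <- digits) _ in hD *.
set SC := \sum_(r <- digits | _) _ in hB *.
have SC0 : 0 <= SC.
  by apply: sumr_ge0 => r _; apply: avg_ge0 => u _; exact: sqr_ge0.
have Q1 : 1 <= Q by exact: Q_ge1.
have e1 : 3 * (Q ^+ 3 * SD) <= 3 * Q ^+ 3 * (Q * (#|gT|%:R ^+ 2 / K%:R)).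
  by rewrite mulrA ler_wpM2l// mulr_ge0// exprn_ge0// ltW.
have e2 : 3 * (Q * SB) <= 3 * Q * (SC + Q * (2 * Q / K%:R)).
  by rewrite mulrA ler_wpM2l// mulr_ge0// ltW.
have e3 : 3 * Q * SC <= 3 * Q ^+ 2 * SC.
  rewrite ler_wpM2r// ler_wpM2l// expr2 ler_peMl// ltW//.
by lra.
Qed.

End energy.

End cocycle.

(** * Substituted words *)

Lemma exists_div_pow2_le (R : realType) (x e : R) : 0 < e -> exists n, x / 2 ^+ n <= e.
Proof.
move=> e0; exists (Num.bound (x / e)).
rewrite ler_pdivrMr ?exprn_gt0// mulrC -ler_pdivrMr//.
exact/ltW/Num.Theory.upper_nthrootP.
Qed.

Section words.
Variables (d : nat) (A : pointedType) (q : 'rV[int]_d) (S : substitution d A).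
Hypothesis q_ge2 : forall i, 2 <= q 0 i.
Implicit Types (t u m r j k : 'rV[int]_d) (x : config d A) (c : A).

Local Notation shift := Defs.shift.
Local Notation rem := (crem q).
Local Notation quo := (cquo q).
Local Notation digits := (digits q_ge2).
Local Notation boxseq := (boxseq q_ge2).

(* The letter at [t] of $\mathcal S^n(c)$, made periodic in [t]. *)
Fixpoint word n t c : A :=
  if n is n'.+1 then S (word n' (quo t) c) (rem t) else c.

Lemma subst_powerE n c t : subst_power q S n c t =
  if iter n quo t == 0 then Some (word n t c) else None.
Proof.
elim: n t => [|n IH] t; first by [].
by rewrite /subst_power iterS -/(subst_power q S n c) /subst_block IH -iterSr; case: ifP.
Qed.

Lemma word_cat a b t c : word (a + b) t c = word a t (word b (iter a quo t) c).
Proof. by elim: a t => //= a IH t; rewrite IH -iterSr. Qed.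

Lemma word_shift_low a t m c : word a (t + scale q a m) c = word a t c.
Proof. by elim: a t => //= a IH t; rewrite scaleS quo_addM// rem_addM IH. Qed.

Lemma word_shift a b t m c :
  word (a + b) (t + scale q a m) c = word a t (word b (iter a quo t + m) c).
Proof. by rewrite word_cat word_shift_low iter_quo_scale// subnn scale0. Qed.

Definition depends_on (T : Type) (W : seq 'rV[int]_d) (f : config d A -> T) :=
  forall x y, {in W, forall j, x j = y j} -> f x = f y.

Lemma shift_shift k m x : shift k (shift m x) = shift (k + m) x.
Proof. by apply/funext => j; rewrite /shift addrA. Qed.

Hypothesis d_gt0 : (0 < d)%N.
Hypothesis A_finite : finite_set [set: A].
Hypothesis S_bij : bijective_subst q S.
Hypothesis S_comm : commutative_subst q S.

Lemma letters_ex : exists n (enc : A -> 'I_n) (dec : 'I_n -> A),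
  cancel enc dec /\ cancel dec enc.
Proof.
have [s sE] := (finite_seqP [set: A]).1 A_finite.
have mem_s a : a \in undup s.
  by rewrite mem_undup; have : [set: A] a by []; rewrite sE.
have idx a : (index a (undup s) < size (undup s))%N by rewrite index_mem.
exists (size (undup s)), (fun a => Ordinal (idx a)), (fun i => nth point (undup s) i).
split=> [a|i]; first by rewrite /= nth_index.
by apply/val_inj; rewrite /= index_uniq// undup_uniq.
Qed.

(** Letters are numbered so that the instructions live in a finite group. Off the box [I] is the
    identity, which makes all its values commute, as the cocycle requires. *)
Lemma perms_ex : exists (n : nat) (enc : A -> 'I_n) (dec : 'I_n -> A)
    (I : 'rV[int]_d -> {perm 'I_n}),
  [/\ cancel enc dec, cancel dec enc, forall i j, commute (I i) (I j) &
      forall j a, box 0 q j -> dec (I j (enc a)) = S a j].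
Proof.
have [n [enc [dec [encK decK]]]] := letters_ex.
pose f j (i : 'I_n) := if `[< box 0 q j >] then enc (S (dec i) j) else i.
have f_inj j : injective (f j).
  rewrite /f; case: asboolP => [bj|_] // a b /(can_inj encK).
  by move=> /(bij_inj (S_bij bj)) /(can_inj decK).
exists n, enc, dec, (fun j => perm (@f_inj j)); split=> // [i j|j a bj].
  apply/permP => a; rewrite !permM !permE /f.
  case: asboolP => bi; case: asboolP => bj//.
  by rewrite !encK; have /(congr1 (@^~ (dec a))) := S_comm bi bj; rewrite /instruction /= => ->.
by rewrite permE /f asboolT// !encK.
Qed.

(** * The energy inequality for local functions *)

Section energy.
Variable R : realType.
Implicit Types G H : config d A -> R.

Local Notation Q := ((size digits)%:R : R).

(** With the factor q^n0 the translations move whole blocks of level n0, so that a function of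
    several coordinates behaves as a function of the letter generating a block. *)
Definition shift_avg n0 N r G x : R := N%:R^-1 *
  \sum_(N <= n < N + N) G (shift (scale q n0 (carry_freq q r n)) x).

(** Packs both sides of the inequality into one local function, whose lower bound can be carried
    from words to points and from points to integrals. *)
Definition energy n0 N G x : R :=
  3 * Q ^+ 2 * \sum_(r <- digits) shift_avg n0 N r G x ^+ 2 - G x ^+ 2.

Definition window n0 N (W : seq 'rV[int]_d) : seq 'rV[int]_d :=
  W ++ [seq j + scale q n0 f | j <- W,
    f <- [seq carry_freq q r n | r <- digits, n <- index_iota N (N + N)]].

Lemma energy_depends_on n0 N G W : depends_on W G ->
  depends_on (window n0 N W) (energy n0 N G).
Proof.
move=> GW x y xy; rewrite /energy (GW x y); last first.
  by move=> j jW; apply: xy; rewrite mem_cat jW.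
congr (_ * _ - _); apply: eq_big_seq => r rD; congr (_ ^+ 2).
congr (_ * _); apply: eq_big_nat => n nN; apply: GW => j jW; apply: xy.
rewrite mem_cat; apply/orP; right; apply: allpairs_f => //.
by apply: allpairs_f => //; rewrite mem_index_iota.
Qed.

Lemma shift_avg_le1 n0 N r G x : (forall x, `|G x| <= 1) ->
  shift_avg n0 N r G x ^+ 2 <= 1.
Proof.
move=> G1; rewrite -real_normK ?num_real// expr_le1//.
by apply: norm_sum_le1 => n; exact: G1.
Qed.

Lemma energy_ge G n0 N x : (forall x, `|G x| <= 1) -> - 1 <= energy n0 N G x.
Proof.
move=> G1; have h : G x ^+ 2 <= 1 by rewrite -real_normK ?num_real// expr_le1.
rewrite /energy; set s := 3 * _ * _; have : 0 <= s; last by lra.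
by rewrite !mulr_ge0 ?exprn_ge0//; apply: sumr_ge0 => r _; exact: sqr_ge0.
Qed.

Lemma energy_le G n0 N x : (forall x, `|G x| <= 1) ->
  `|energy n0 N G x| <= 1 + 3 * Q ^+ 3.
Proof.
move=> G1; have Ge := energy_ge n0 N x G1.
have hs : \sum_(r <- digits) shift_avg n0 N r G x ^+ 2 <= Q.
  rewrite -[Q]mulr1 mulr_natl -iter_addr_0 -(count_predT digits).
  by rewrite -big_const_seq; apply: ler_sum => r _; exact: shift_avg_le1.
have Q3 : 0 <= Q ^+ 3 by rewrite exprn_ge0.
have h3 : 3 * Q ^+ 2 * \sum_(r <- digits) shift_avg n0 N r G x ^+ 2 <= 3 * Q ^+ 3.
  by rewrite [Q ^+ 3]exprSr mulrA ler_wpM2l// mulr_ge0// exprn_ge0.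
rewrite ler_norml; apply/andP; split; first by lra.
by rewrite /energy; have := sqr_ge0 (G x); lra.
Qed.

Let carry M t : R := (iter M quo t != 0)%:R.

(** The indicator of the complement of the box vanishes on the box, so [avg_box_shift] bounds the
    proportion of points that a translation expels. *)
Let avg_carry M f : avg (boxseq M) (fun u => carry M (u + f)) <= 2 * znorm R f / 2 ^+ M.
Proof.
have h1 t : `|carry M t| <= 1 by rewrite /carry; case: eqP; rewrite ?normr0 ?normr1.
have := avg_box_shift q_ge2 M f h1; rewrite mulr1.
have -> : avg (boxseq M) (carry M) = 0.
  rewrite -[RHS](@avg_const _ _ (boxseq M) 0 (size_boxseq_gt0 q_ge2 M)).
  by apply: eq_avg => u; rewrite mem_boxseq /carry => ->.
by rewrite subr0; apply: le_trans; exact: ler_norm.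
Qed.

(* Along a box of level [n0 + M] filled by a level block, and away from its
   boundary, [G] is a function of [rho M u] as in [energy_bound]. *)
Lemma block_energy G W (e : R) : 0 < e -> depends_on W G ->
  (forall x, `|G x| <= 1) ->
  exists n1 K1, forall n0 K, (n1 <= n0)%N -> (K1 <= K)%N -> (0 < K)%N ->
  exists b, forall L c t,
    - e <= avg (boxseq b) (fun v =>
      energy n0 (K ^ 2) G (shift (v + scale q b t) (fun j => word (b + L) j c))).
Proof.
move=> e0 GW G1; have e3 : 0 < e / 3 by lra.
have sum3 (x y z c : R) : y <= x + c -> c <= e / 3 -> z <= e / 3 ->
  - (2 * e / 3) <= x - y - z by lra.
have eE : - e = - (2 * e / 3) - e / 3 by lra.
have [n [enc [dec [I [encK decK commI IE]]]]] := perms_ex.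
have wordE (l : nat) t c : word l t c = dec (fun_of_perm (rho q I l t) (enc c)).
  elim: l t => [|l IH] t /=; first by rewrite perm1 encK.
  by rewrite permM IH -IE ?decK//; exact: rem_box.
(* Level from which few positions in a block are so close to its boundary that the window [W] sticks
   out. *)
have [n1 n1E] := exists_div_pow2_le (\sum_(j <- W) 2 * znorm R j) e3.
set C : R := 2 * Q + 3 * Q ^+ 4 * #|{perm 'I_n}|%:R ^+ 2 + 6 * Q ^+ 3.
exists n1, (Num.bound (C / (e / 3))) => n0 K n10 KC K0.
have n0E : (\sum_(j <- W) 2 * znorm R j) / 2 ^+ n0 <= e / 3.
  apply: le_trans n1E; rewrite ler_wpM2l//.
    by apply: sumr_ge0 => j _; rewrite mulr_ge0// znorm_ge0.
  by rewrite lef_pV2 ?posrE ?exprn_gt0// ler_weXn2l// ler1n.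
have KE : C / K%:R <= e / 3.
  rewrite ler_pdivrMr ?ltr0n// mulrC -ler_pdivrMr//.
  apply: le_trans (ltW (archi_boundP _)) _; last by rewrite ler_nat.
  by rewrite divr_ge0 ?(ltW e3)// /C !addr_ge0 ?mulr_ge0// ?exprn_ge0.
pose N := (K ^ 2)%N.
pose F : R := 3 * Q ^+ 2 * \sum_(r <- digits) \sum_(N <= n < N + N)
  2 * znorm R (carry_freq q r n).
have [M1 M1E] := exists_div_pow2_le F e3.
(* The summand [N + N] meets the requirement of [energy_bound]; [M1] makes it rare that a translate
   leaves the box of level [M]. *)
pose M := (M1 + (N + N))%N.
have ME : F / 2 ^+ M <= e / 3.
  apply: le_trans M1E; rewrite ler_wpM2l//.
    rewrite /F !mulr_ge0 ?exprn_ge0//; apply: sumr_ge0 => r _.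
    by apply: sumr_ge0 => p _; rewrite mulr_ge0// znorm_ge0.
  rewrite lef_pV2 ?posrE ?exprn_gt0// ler_weXn2l// ?ler1n// leq_addr//.
exists (n0 + M)%N => L c t; set z := fun j => word _ j c; set a := word L t c.
pose phi r (g : {perm 'I_n}) := G (fun j => word n0 (r + j) (dec (g (enc a)))).
have GE r u : {in W, forall j, iter n0 quo (r + j) = 0} -> iter M quo u = 0 ->
    G (shift (r + scale q n0 u + scale q (n0 + M) t) z) = phi r (rho q I M u).
  move=> rW uM; apply: GW => j jW; rewrite /shift /z.
  rewrite addrA word_shift addrA [j + r]addrC.
  have -> : iter (n0 + M) quo (r + j + scale q n0 u) = 0.
    by rewrite addnC iterD iter_quo_scale// subnn scale0 rW// add0r.
  rewrite add0r -/a.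
  by rewrite word_shift rW// add0r -wordE.
rewrite avg_boxD.
have hr : {in boxseq n0, forall r, - (2 * e / 3) - \sum_(j <- W) carry n0 (r + j) <=
   avg (boxseq M) (fun u => energy n0 (K ^ 2) G
     (shift (r + scale q n0 u + scale q (n0 + M) t) z))}.
  move=> r rB; have [rW|nrW] := pselect {in W, forall j, iter n0 quo (r + j) = 0}; last first.
    (* If the window sticks out of the block, only the trivial bound -1 is available, but then the
       sum of the carries is at least 1 and pays for it. *)
    apply: (@le_trans _ _ (-1)).
      have [j0 j0W j0E] : exists2 j, j \in W & iter n0 quo (r + j) != 0.
        apply: contrapT => h; apply: nrW => j jW; apply/eqP/negPn/negP => h'.
        by apply: h; exists j.
      suff h : 1 <= \sum_(j <- W) carry n0 (r + j).
        rewrite -opprD lerN2 (le_trans h)// lerDr divr_ge0// mulr_ge0// ltW//.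
      rewrite (big_rem j0)//= /carry j0E -[leLHS]addr0 lerD//.
      by apply: sumr_ge0 => j _.
    rewrite -[leLHS](@avg_const _ _ (boxseq M) (-1) (size_boxseq_gt0 q_ge2 M)).
    by apply: ler_avg => u _; exact: energy_ge.
  apply: (@le_trans _ _ (- (2 * e / 3))).
    by rewrite gerBl; apply: sumr_ge0.
  (* Pays for the translates leaving the box of level [M]: there the squared average is only known
     to be at most 1. *)
  pose bad u : R := 3 * Q ^+ 2 * \sum_(r' <- digits) \sum_(N <= p < N + N)
    carry M (u + carry_freq q r' p).
  have badE : avg (boxseq M) bad <= e / 3.
    rewrite avgZ; apply: le_trans ME; rewrite /F -mulrA ler_wpM2l ?mulr_ge0 ?exprn_ge0//.
    rewrite avg_sum mulr_suml; apply: ler_sum => r' _.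
    rewrite avg_sum mulr_suml; apply: ler_sum => p _; exact: avg_carry.
  have main := @energy_bound _ _ q_ge2 _ _ commI R (phi r) (fun _ => G1 _) K M K0 (leq_addl _ _).
  rewrite -/N -/C in main.
  have := lexx (avg (boxseq M) (fun u => 3 * Q ^+ 2 * (\sum_(r' <- digits)
     carry_avg q I (phi r) N M r' u ^+ 2) - phi r (rho q I M u) ^+ 2 - bad u)).
  rewrite {1}avgB {1}avgB avgZ avg_sum => low.
  have {}low : - (2 * e / 3) <= avg (boxseq M) (fun u => 3 * Q ^+ 2 * (\sum_(r' <- digits)
     carry_avg q I (phi r) N M r' u ^+ 2) - phi r (rho q I M u) ^+ 2 - bad u).
    by apply: le_trans low; apply: sum3 main KE badE.
  apply: le_trans low _; apply: ler_avg => u; rewrite mem_boxseq => /eqP uM.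
  rewrite /energy -/N GE// addrAC lerB// lerBlDr -mulrDr.
  rewrite ler_wpM2l ?mulr_ge0 ?exprn_ge0// -big_split/=; apply: ler_sum => r' _.
  have SE p : iter M quo (u + carry_freq q r' p) = 0 ->
      G (shift (scale q n0 (carry_freq q r' p))
        (shift (r + scale q n0 u + scale q (n0 + M) t) z)) =
      phi r (rho q I M (u + carry_freq q r' p)).
    move=> h; rewrite shift_shift -GE//; set v := scale q _ t.
    have -> // : scale q n0 (carry_freq q r' p) + (r + scale q n0 u + v) =
        r + scale q n0 (u + carry_freq q r' p) + v.
    by rewrite addrC scale_add !addrA [X in X = _]addrAC.
  have [good|bad_p] := pselect (forall p, (N <= p < N + N)%N ->
      iter M quo (u + carry_freq q r' p) = 0).
    rewrite -[leLHS]addr0 lerD//; last by apply: sumr_ge0.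
    rewrite le_eqVlt; apply/orP; left; apply/eqP; congr (_ ^+ 2); congr (_ * _).
    by apply: eq_big_nat => p pN; rewrite SE// good.
  apply: (@le_trans _ _ 1).
    rewrite -real_normK ?num_real// expr_le1//.
    by apply: norm_sum_le1 => p; exact: G1.
  rewrite -[leLHS]add0r lerD ?sqr_ge0//.
  have [p pN pE] : exists2 p, (N <= p < N + N)%N & iter M quo (u + carry_freq q r' p) != 0.
    apply: contrapT => h; apply: bad_p => p pN; apply/eqP/negPn/negP => h'.
    by apply: h; exists p.
  rewrite (bigD1_seq p) ?mem_index_iota ?iota_uniq//= /carry pE -[leLHS]addr0 lerD//.
  by apply: sumr_ge0.
rewrite eE; apply: le_trans (ler_avg hr).
rewrite avgB avg_const ?size_boxseq_gt0// lerB// avg_sum; apply: le_trans n0E.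
by rewrite mulr_suml; apply: ler_sum => j _; exact: avg_carry.
Qed.

(** The definition of the subshift provides a word of unknown level n. Adding 0 to [W] forces a
    translate of the whole box of level b into the box of level n, and comparing cardinalities gives
    b <= n. *)
Lemma word_of_subst_shift b (W : seq 'rV[int]_d) x : subst_shift q S x ->
  exists L c k, forall t j, t \in boxseq b -> j \in W ->
    x (j + t) = word (b + L) (j + t + k) c.
Proof.
move=> /(_ [set` [seq j + t | j <- 0 :: W, t <- boxseq b]]) [|n [c [k H]]].
  exact: finite_seq.
have Hw j t : j \in 0 :: W -> t \in boxseq b ->
    iter n quo (j + t + k) = 0 /\ x (j + t) = word n (j + t + k) c.
  move=> jW tB; have := H (j + t) (allpairs_f (fun j t => j + t) jW tB).
  by rewrite subst_powerE; case: eqP => // -> [].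
have bn : (b <= n)%N.
  have Q1 := size_digits_gt1 q_ge2 d_gt0.
  rewrite -(leq_exp2l _ _ Q1) -!size_boxseq -(size_map (+%R^~ k)).
  apply: uniq_leq_size; first by rewrite (map_inj_uniq (addIr k)) boxseq_uniq.
  move=> _ /mapP[t tB ->]; rewrite mem_boxseq.
  by have [] := Hw 0 t (mem_head _ _) tB; rewrite add0r => ->.
exists (n - b)%N, c, k => t j tB jW; rewrite subnKC//.
by have [] := Hw j t _ tB; rewrite // inE jW orbT.
Qed.

(** In a point of the subshift the blocks of level b are not aligned with the origin. The offset
    splits into a multiple of q^b, absorbed by the arbitrary [t] of the hypothesis, and a remainder
    v0 in the box of level b, which [avg_box_shift] removes at a second cost e once l is large. *)
Lemma orbit_average H W b (e C : R) : 0 < e -> depends_on W H ->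
  (forall x, `|H x| <= C) ->
  (forall L c t, - e <= avg (boxseq b) (fun v =>
      H (shift (v + scale q b t) (fun j => word (b + L) j c)))) ->
  exists l, forall x, subst_shift q S x ->
    - (2 * e) <= avg (boxseq l) (fun t => H (shift t x)).
Proof.
move=> e0 HW HC Hb; have C0 : 0 <= C by exact: le_trans (HC point).
have [l0 l0E] := exists_div_pow2_le (2 * C * \sum_(v <- boxseq b) znorm R v) e0.
pose l := (b + l0)%N; exists l => x xS.
have [L [c [k xE]]] := word_of_subst_shift l W xS.
pose z : config d A := fun j => word (l + L) j c.
pose t0 := iter b quo k; pose v0 := k - scale q b t0.
have v0B : v0 \in boxseq b.
  by rewrite mem_boxseq /v0 -scaleN iter_quo_scale// subnn scale0 subrr.
pose h t := H (shift (t + scale q b t0) z).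
have -> : avg (boxseq l) (fun t => H (shift t x)) = avg (boxseq l) (fun t => h (t + v0)).
  apply: eq_avg => t tB; apply: HW => j jW.
  rewrite /shift xE// /z; congr (word _ _ _).
  have -> : t + v0 + scale q b t0 = t + k by rewrite -addrA subrK.
  by rewrite addrA.
have hC t : `|h t| <= C by exact: HC.
have := avg_box_shift q_ge2 l v0 hC; set a1 := avg _ _; set a2 := avg _ _ => h12.
have small : 2 * C * znorm R v0 / 2 ^+ l <= e.
  apply: le_trans l0E.
  have hn : znorm R v0 <= \sum_(v <- boxseq b) znorm R v.
    rewrite (bigD1_seq v0) ?boxseq_uniq//= -[leLHS]addr0 lerD//.
    by apply: sumr_ge0 => v _; exact: znorm_ge0.
  apply: ler_pM; rewrite ?mulr_ge0 ?znorm_ge0 ?invr_ge0 ?exprn_ge0//.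
    by rewrite ler_wpM2l// mulr_ge0.
  by rewrite lef_pV2 ?posrE ?exprn_gt0// ler_weXn2l ?ler1n// leq_addl.
have low : - e <= a2.
  rewrite /a2 /l avg_boxD exchange_avg.
  rewrite -[leLHS](@avg_const _ _ (boxseq l0) (- e) (size_boxseq_gt0 q_ge2 l0)).
  apply: ler_avg => t _; apply: le_trans (Hb (l0 + L)%N c (t + t0)) _.
  rewrite le_eqVlt; apply/orP; left; apply/eqP; apply: eq_avg => v _.
  rewrite /h scale_add addrA; congr (H (shift _ _)).
  by apply/funext => j; rewrite /z /l addnA.
have := le_trans h12 small; rewrite ler_distl => /andP[]; lra.
Qed.

End energy.

End words.

(** * Square-integrable functions *)

Section L2.
Context d (T : measurableType d) (R : realType).
Variable mu : {finite_measure set T -> \bar R}.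
Implicit Types F G : T -> R.

Definition square_int F := measurable_fun setT F /\
  mu.-integrable setT (EFin \o (fun x => F x ^+ 2)).

Definition ip F G : R := \int[mu]_x (F x * G x).

Lemma integrable_le F G : measurable_fun setT F -> (forall x, `|F x| <= G x) ->
  mu.-integrable setT (EFin \o G) -> mu.-integrable setT (EFin \o F).
Proof.
move=> mF FG; apply: le_integrable => //; first exact/measurable_EFinP.
by move=> x _ /=; rewrite lee_fin (le_trans (FG x))// ler_norm.
Qed.

Lemma integrable_sumr (I : Type) (s : seq I) (F : I -> T -> R) :
  (forall i, mu.-integrable setT (EFin \o F i)) ->
  mu.-integrable setT (EFin \o (fun x => \sum_(i <- s) F i x)).
Proof.
move=> iF; rewrite (_ : _ \o _ = fun x => \sum_(i <- s) (EFin \o F i) x)%E.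
  exact: integrable_sum.
by apply/funext => x /=; rewrite sumEFin.
Qed.

Lemma Rintegral_sum (I : Type) (s : seq I) (F : I -> T -> R) :
  (forall i, mu.-integrable setT (EFin \o F i)) ->
  \int[mu]_x \sum_(i <- s) F i x = \sum_(i <- s) \int[mu]_x F i x.
Proof.
move=> iF; elim: s => [|i s IH].
  rewrite big_nil (@eq_Rintegral _ _ _ _ _ (fun=> 0)).
    by rewrite Rintegral_cst// mul0r.
  by move=> x _; rewrite big_nil.
rewrite big_cons -IH -(RintegralD measurableT (iF i) (integrable_sumr s iF)).
by apply: eq_Rintegral => x _; rewrite big_cons.
Qed.

Lemma square_int_mul F G : square_int F -> square_int G ->
  mu.-integrable setT (EFin \o (fun x => F x * G x)).
Proof.
move=> [mF iF] [mG iG].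
apply: (@integrable_le _ (fun x => F x ^+ 2 + G x ^+ 2)).
- exact: measurable_funM.
- move=> x; have := sqr_ge0 (F x + G x); have := sqr_ge0 (F x - G x).
  have := sqr_ge0 (F x); have := sqr_ge0 (G x).
  by move: (F x) (G x) => a b *; rewrite ler_norml; apply/andP; split; nra.
- exact: (integrableD measurableT iF iG).
Qed.

Lemma square_intZ a F : square_int F -> square_int (fun x => a * F x).
Proof.
move=> [mF iF]; split; first exact: measurable_funM.
rewrite (_ : _ \o _ = fun x => (a ^+ 2)%:E * (EFin \o (fun x => F x ^+ 2)%R) x)%E.
  exact: integrableZl.
by apply/funext => x /=; rewrite -EFinM exprMn.
Qed.

Lemma square_intD F G : square_int F -> square_int G ->
  square_int (fun x => F x + G x).
Proof.
move=> [mF iF] [mG iG]; split; first exact: measurable_funD.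
apply: (@integrable_le _ (fun x => 2 * F x ^+ 2 + 2 * G x ^+ 2)).
- by apply: measurable_funX; exact: measurable_funD.
- move=> x; rewrite ger0_norm ?sqr_ge0//; have := sqr_ge0 (F x - G x).
  by move: (F x) (G x) => a b *; nra.
- exact: (integrableD measurableT (integrableZl measurableT 2 iF)
    (integrableZl measurableT 2 iG)).
Qed.

Lemma square_intB F G : square_int F -> square_int G ->
  square_int (fun x => F x - G x).
Proof.
move=> hF hG; rewrite (_ : (fun _ => _) = fun x => F x + (-1) * G x).
  by apply: square_intD => //; exact: square_intZ.
by apply/funext => x; rewrite mulN1r.
Qed.

Lemma square_int_bounded F C : measurable_fun setT F -> (forall x, `|F x| <= C) ->
  square_int F.
Proof.
move=> mF FC; split => //.
apply: (@integrable_le _ (fun=> C ^+ 2)).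
- exact: measurable_funX.
- by move=> x; rewrite normrX lerXn2r// nnegrE// (le_trans _ (FC x)).
- exact: finite_measure_integrable_cst.
Qed.

Lemma square_int_sum (I : Type) (s : seq I) (F : I -> T -> R) :
  (forall i, square_int (F i)) -> square_int (fun x => \sum_(i <- s) F i x).
Proof.
move=> hF; elim: s => [|i s IH].
  rewrite (_ : (fun _ => _) = fun=> 0).
    by apply: (@square_int_bounded _ 0) => // x; rewrite normr0.
  by apply/funext => x; rewrite big_nil.
rewrite (_ : (fun _ => _) = fun x => F i x + \sum_(j <- s) F j x).
  exact: square_intD.
by apply/funext => x; rewrite big_cons.
Qed.

Lemma ipC F G : ip F G = ip G F.
Proof. by apply: eq_Rintegral => x _; rewrite mulrC. Qed.

Lemma ip_ge0 F : 0 <= ip F F.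
Proof. by apply: Rintegral_ge0 => x _; rewrite -expr2 sqr_ge0. Qed.

Lemma ipZl a F G : square_int F -> square_int G ->
  ip (fun x => a * F x) G = a * ip F G.
Proof.
move=> hF hG; rewrite -RintegralZl//; last exact: square_int_mul.
by apply: eq_Rintegral => x _; rewrite mulrA.
Qed.

Lemma ip_suml (I : Type) (s : seq I) (F : I -> T -> R) G :
  (forall i, square_int (F i)) -> square_int G ->
  ip (fun x => \sum_(i <- s) F i x) G = \sum_(i <- s) ip (F i) G.
Proof.
move=> hF hG; rewrite /ip -Rintegral_sum; last by move=> i; exact: square_int_mul.
by apply: eq_Rintegral => x _; rewrite mulr_suml.
Qed.

Lemma ip_add_le F G : square_int F -> square_int G ->
  ip (fun x => F x + G x) (fun x => F x + G x) <= 2 * ip F F + 2 * ip G G.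
Proof.
move=> hF hG; have iF := square_int_mul hF hF; have iG := square_int_mul hG hG.
have iF2 := integrableZl measurableT 2 iF; have iG2 := integrableZl measurableT 2 iG.
rewrite -!RintegralZl// -RintegralD//; apply: le_Rintegral => //.
- by apply: square_int_mul; exact: square_intD.
- exact: (integrableD measurableT iF2 iG2).
by move=> x _; have := sqr_ge0 (F x - G x); lra.
Qed.

Lemma ip_sum_le (I : eqType) (s : seq I) (F : I -> T -> R) :
  (forall i, square_int (F i)) ->
  ip (fun x => \sum_(i <- s) F i x) (fun x => \sum_(i <- s) F i x) <=
  (size s)%:R * \sum_(i <- s) ip (F i) (F i).
Proof.
move=> hF; pose X i : T -> R := fun x => F i x ^+ 2.
have iX i : mu.-integrable setT (EFin \o X i) by case: (hF i).
have iS := integrable_sumr s iX.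
rewrite -Rintegral_sum// -RintegralZl//.
apply: le_Rintegral => //.
- by apply: square_int_mul; exact: square_int_sum.
- exact: (integrableZl measurableT _ iS).
by move=> x _; rewrite -expr2; exact: sqr_sum_le.
Qed.

Lemma ip_sub_cvg0 F (F_ : nat -> T -> R) : square_int F ->
  (forall n, measurable_fun setT (F_ n)) ->
  (forall x, F_ n x @[n --> \oo] --> F x) ->
  (forall n x, `|F_ n x| <= `|F x|) ->
  forall e, 0 < e -> exists n,
    square_int (F_ n) /\ ip (fun x => F x - F_ n x) (fun x => F x - F_ n x) <= e.
Proof.
move=> hF mF_ F_F leF e e0; have [mF iF] := hF.
have hF_ n : square_int (F_ n).
  split=> //; apply: (integrable_le _ _ iF).
    exact: measurable_funX.
  move=> x; rewrite ger0_norm ?sqr_ge0// -[leLHS]real_normK ?num_real//.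
  by rewrite -[leRHS]real_normK ?num_real// lerXn2r ?nnegrE.
pose f n x := ((F x - F_ n x) ^+ 2)%:E.
have cvg : (\int[mu]_x f n x)%E @[n --> \oo] --> (\int[mu]_x (cst 0) x)%E.
  apply: (@dominated_cvg _ _ _ _ setT measurableT f (cst 0%E) (fun x => (4 * F x ^+ 2)%:E)).
  - move=> n; apply/measurable_EFinP; apply: measurable_funX.
    exact: measurable_funB.
  - move=> x _; apply/cvg_EFin; first by apply: nearW.
    rewrite /f /=; apply: (@cvg_trans _ ((F x - F_ n x) ^+ 2 @[n --> \oo])) => //.
    rewrite (_ : 0%R = (F x - F x) ^+ 2); last by rewrite subrr expr0n.
    have h : (F x - F_ n x) @[n --> \oo] --> F x - F x.
      by apply: cvgB; [exact: cvg_cst|exact: F_F].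
    exact: (cvgM h h).
  - by [].
  - exact: (integrableZl measurableT 4 iF).
  - move=> n x _; rewrite /f lee_fin ger0_norm ?sqr_ge0//.
    have h : F_ n x ^+ 2 <= F x ^+ 2.
      rewrite -[leLHS]real_normK ?num_real// -[leRHS]real_normK ?num_real//.
      by rewrite lerXn2r ?nnegrE.
    by have := sqr_ge0 (F x + F_ n x); move: h; move: (F x) (F_ n x) => a b; nra.
rewrite integral0 in cvg.
have /fine_cvgP[_ /cvgrPdist_le/(_ e e0)[n _ /(_ n (leqnn n))]] := cvg.
rewrite sub0r normrN => h; exists n; split => //.
by apply: le_trans h; exact: ler_norm.
Qed.

End L2.

(** * Cylinders and density of local functions in L^2 *)

Section cylinders.
Variables (d : nat) (A : pointedType).
Implicit Types (x y : config d A) (k j : 'rV[int]_d).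

Local Notation shift := Defs.shift.

Definition agree (W : seq 'rV[int]_d) x : set (config d A) :=
  [set y | {in W, forall j, x j = y j}].

Lemma agree_filter x : Filter (filter_from [set: seq 'rV[int]_d] (agree^~ x)).
Proof.
apply: filter_from_filter; first by exists [::].
move=> V W _ _; exists (V ++ W) => // y xy; split => j jW; apply: xy;
  by rewrite mem_cat jW ?orbT.
Qed.

Lemma open_agree (O : set (config d A)) x :
  @open (fullshift d A) O -> O x -> exists W, agree W x `<=` O.
Proof.
move=> oO Ox; have F := agree_filter x.
have cv : filter_from [set: seq 'rV[int]_d] (agree^~ x) --> (x : fullshift d A).
  apply/cvg_sup => j B /=.
  move=> [_ [[C _ <-] Cx] CB]; exists [:: j] => // y xy; apply: CB.
  by rewrite /= -(xy j) ?mem_head.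
have [|W _ WO] := cv O; last by exists W.
by apply: open_nbhs_nbhs; split.
Qed.

Lemma open_of_agree (B : set (config d A)) :
  (forall x, B x -> exists W, agree W x `<=` B) -> @open (fullshift d A) B.
Proof.
move=> BW; rewrite openE => x /BW[W WB].
suff : nbhs (x : fullshift d A) (agree W x) by apply: filterS.
elim: W {WB} => [|j W IH].
  by apply: filterS filterT => y _ j; rewrite in_nil.
have : nbhs (x : fullshift d A) [set y | y j = x j].
  have := @proj_continuous _ (fun _ : 'rV[int]_d => discrete_topology A) j x.
  by move=> /(_ [set x j]); apply; exact/principal_filterP.
move: IH; apply: filterS2 => y yW yj l; rewrite inE => /orP[/eqP ->//|].
exact: yW.
Qed.

Lemma depends_on_measurable W (B : set (config d A)) :
  depends_on W B -> measurable B.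
Proof.
move=> WB; apply: sub_sigma_algebra; apply: open_of_agree => x Bx.
by exists W => y xy; rewrite -(WB _ _ xy).
Qed.

Lemma depends_on_measurable_fun (R : realType) W (f : config d A -> R) :
  depends_on W f -> measurable_fun setT f.
Proof.
move=> Wf _ Y _; apply: (@depends_on_measurable W) => x y xy.
by rewrite /setI /preimage /= (Wf _ _ xy).
Qed.

Lemma measurable_shift k : measurable_fun setT (shift k : config d A -> config d A).
Proof.
apply: (@measurability _ _ (config d A) (config d A) setT (shift k)
  (@open (fullshift d A) : set (set (config d A)))) => //.
move=> _ [U oU <-]; rewrite setTI; apply: sub_sigma_algebra.
apply: open_of_agree => x Ox; have [W WO] := open_agree oU Ox.
exists [seq j + k | j <- W] => y xy; apply: WO => j jW.
by rewrite /Defs.shift; apply: xy; exact: (map_f (fun j => j + k)).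
Qed.

(** The complement is open, since not belonging to the subshift is witnessed on a finite set of
    coordinates. *)
Lemma measurable_subst_shift q (S : substitution d A) : measurable (subst_shift q S).
Proof.
rewrite -[subst_shift q S]setCK; apply: measurableC; apply: sub_sigma_algebra.
apply: open_of_agree => x xS.
have [D fD nD] : exists2 D, finite_set D & ~ exists n c k,
    forall j, D j -> subst_power q S n c (j + k) = Some (x j).
  by apply: contrapT => h; apply: xS => D fD; apply: contrapT => h'; apply: h; exists D.
have [W DW] := (finite_seqP D).1 fD; exists W => y xy yS; apply: nD.
have [n [c [k H]]] := yS D fD; exists n, c, k => j Dj.
by rewrite H// xy//; move: Dj; rewrite DW.
Qed.

Section approx.
Variables (R : realType) (mu : probability (config d A) R).
Implicit Types F G : config d A -> R.

Definition approximable F := square_int mu F /\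
  forall e, 0 < e -> exists W G C, [/\ depends_on W G, forall x, `|G x| <= C &
    ip mu (fun x => F x - G x) (fun x => F x - G x) <= e].

Lemma depends_on_square_int W G C : depends_on W G -> (forall x, `|G x| <= C) ->
  square_int mu G.
Proof. by move=> WG; apply: square_int_bounded; exact: depends_on_measurable_fun WG. Qed.

Lemma approximable_depends_on W G C : depends_on W G -> (forall x, `|G x| <= C) ->
  approximable G.
Proof.
move=> WG GC; split; first exact: (depends_on_square_int WG GC).
move=> e e0; exists W, G, C; split => //.
rewrite /ip (@eq_Rintegral _ _ _ _ _ (fun=> 0)); first by rewrite Rintegral_cst// mul0r ltW//.
by move=> x _; rewrite subrr mul0r.
Qed.

Lemma approximableD F G : approximable F -> approximable G ->
  approximable (fun x => F x + G x).
Proof.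
move=> [hF aF] [hG aG]; split; first exact: square_intD.
move=> e e0; have e4 : 0 < e / 4 by lra.
have [V [F' [B [VF' F'B F'e]]]] := aF _ e4.
have [W [G' [C [WG' G'C G'e]]]] := aG _ e4.
exists (V ++ W), (fun x => F' x + G' x), (B + C); split.
- move=> x y xy; rewrite (VF' x y) ?(WG' x y)// => j jW; apply: xy;
    by rewrite mem_cat jW ?orbT.
- by move=> x; apply: le_trans (ler_normD _ _) _; exact: lerD.
have E : (fun x => F x + G x - (F' x + G' x)) =
    (fun x => (F x - F' x) + (G x - G' x)).
  by apply/funext => x; ring.
have hF' := depends_on_square_int VF' F'B; have hG' := depends_on_square_int WG' G'C.
rewrite E; apply: le_trans (ip_add_le _ _) _; try exact: square_intB.
by lra.
Qed.

Lemma approximableZ a F : approximable F -> approximable (fun x => a * F x).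
Proof.
move=> [hF aF]; split; first exact: square_intZ.
move=> e e0; have e4 : 0 < e / (1 + a ^+ 2).
  by rewrite divr_gt0// ltr_pwDl// sqr_ge0.
have [V [F' [B [VF' F'B F'e]]]] := aF _ e4.
exists V, (fun x => a * F' x), (`|a| * B); split.
- by move=> x y xy; rewrite (VF' x y).
- by move=> x; rewrite normrM ler_wpM2l.
have hF' := depends_on_square_int VF' F'B.
have hB := square_intB hF hF'.
have E : (fun x => a * F x - a * F' x) = (fun x => a * (F x - F' x)).
  by apply/funext => x; rewrite mulrBr.
rewrite E ipZl//; last exact: square_intZ.
rewrite ipC ipZl// mulrA -expr2.
apply: (@le_trans _ _ ((1 + a ^+ 2) * (e / (1 + a ^+ 2)))).
  by rewrite ler_pM ?sqr_ge0 ?ip_ge0// lerDr.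
by rewrite mulrC divfK// gt_eqF// ltr_pwDl// sqr_ge0.
Qed.

Lemma approximable_sum (I : Type) (s : seq I) (F : I -> config d A -> R) :
  (forall i, approximable (F i)) -> approximable (fun x => \sum_(i <- s) F i x).
Proof.
move=> aF; elim: s => [|i s IH].
  rewrite (_ : (fun _ => _) = fun=> 0).
    by apply: (@approximable_depends_on [::] _ 0) => // x; rewrite normr0.
  by apply/funext => x; rewrite big_nil.
rewrite (_ : (fun _ => _) = fun x => F i x + \sum_(j <- s) F j x).
  exact: approximableD.
by apply/funext => x; rewrite big_cons.
Qed.

Lemma approximable_cvg F (F_ : nat -> config d A -> R) : square_int mu F ->
  (forall n, approximable (F_ n)) ->
  (forall x, F_ n x @[n --> \oo] --> F x) ->
  (forall n x, `|F_ n x| <= `|F x|) -> approximable F.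
Proof.
move=> hF aF_ F_F leF; split => // e e0; have e4 : 0 < e / 4 by lra.
have mF_ n : measurable_fun setT (F_ n) by case: (aF_ n) => -[].
have [n [hn ne]] := ip_sub_cvg0 hF mF_ F_F leF e4.
have [V [F' [B [VF' F'B F'e]]]] := (aF_ n).2 _ e4.
exists V, F', B; split=> //.
have E : (fun x => F x - F' x) = (fun x => (F x - F_ n x) + (F_ n x - F' x)).
  by apply/funext => x; rewrite addrA subrK.
have hF' := depends_on_square_int VF' F'B.
rewrite E; apply: le_trans (ip_add_le _ _) _; try exact: square_intB.
by lra.
Qed.

(** Dynkin's theorem, the open sets being stable under intersection. An open [U] is exhausted by the
    points whose cylinder over [W n] lies in [U], where the finite sets [W n] increase to the
    countable lattice; each such stage depends only on the coordinates in [W n]. *)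
Lemma approximable_indic (B : set (config d A)) : measurable B ->
  approximable (\1_B : config d A -> R).
Proof.
have hB C : measurable C -> square_int mu (\1_C : config d A -> R).
  move=> mC; apply: (@square_int_bounded _ _ _ _ _ 1); first exact: measurable_indic.
  by move=> x; rewrite indicE; case: (_ \in _); rewrite ?normr1 ?normr0.
have lim C (f : nat -> config d A -> R) : measurable C ->
    (forall n, approximable (f n)) -> (forall n x, `|f n x| <= \1_C x) ->
    (forall x, C x -> exists m, forall n, (m <= n)%N -> f n x = 1) ->
    approximable (\1_C : _ -> R).
  move=> mC af fC fx; apply: (approximable_cvg (F_ := f)) => //; first exact: hB.
  - move=> x; have [xC|xC] := pselect (C x).
      by have [m fm] := fx x xC; rewrite indicE mem_set//; apply: cvg_near_cst; exists m.
    rewrite indicE memNset//; apply: cvg_near_cst; apply: nearW => n.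
    by apply/eqP; rewrite -normr_le0; have := fC n x; rewrite indicE memNset.
  - by move=> n x; rewrite (le_trans (fC n x))// ler_norm.
have ind01 C x : 0 <= (\1_C x : R) <= 1 by rewrite indicE; case: (_ \in _); rewrite ?lexx ?ler01.
apply: (@dynkin_induction _ _ (@open (fullshift d A) : set (set (config d A)))
  (fun B => approximable (\1_B : _ -> R))) => //.
- by move=> U V oU oV; exact: openI.
- apply: (@approximable_depends_on [::] _ 1); first by move=> x y _; rewrite !indicE !in_setT.
  by move=> x; rewrite indicE in_setT normr1.
- move=> U oU.
  have [W Wnd Wcofinal] : exists2 W : nat -> seq 'rV[int]_d,
      forall m n, (m <= n)%N -> {subset W m <= W n} &
      forall V : seq 'rV[int]_d, exists n, {subset V <= W n}.
    pose W n := pmap (@unpickle 'rV[int]_d) (iota 0 n).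
    have WS m n : (m <= n)%N -> {subset W m <= W n}.
      move=> mn j; rewrite !mem_pmap => /mapP[i im ->]; apply: map_f.
      by move: im; rewrite !mem_iota !add0n /= => /leq_trans -> //.
    exists W => // V.
    exists (\max_(j <- V) (pickle j).+1)%N => j jV; rewrite mem_pmap.
    rewrite -(pickleK j); apply: map_f; rewrite mem_iota add0n /=.
    exact: (@leq_bigmax_seq _ V xpredT (fun j => (pickle j).+1) j jV isT).
  pose f n : config d A -> R := \1_[set x | agree (W n) x `<=` U].
  apply: (lim U f).
  - exact: sub_sigma_algebra.
  - move=> n; apply: (@approximable_depends_on (W n) _ 1).
      move=> x y xy; rewrite /f !indicE; congr (_ _); congr (nat_of_bool _).
      by apply/idP/idP => /set_mem /= h; apply/mem_set => z yz; apply: h => j jW;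
        rewrite -(yz j jW) (xy j jW).
    by move=> x; have /andP[h1 h2] := ind01 [set x | agree (W n) x `<=` U] x; rewrite ger0_norm.
  - move=> n x; have /andP[h1 h2] := ind01 [set x | agree (W n) x `<=` U] x.
    rewrite ger0_norm// !indicE ler_nat; case: (boolP (x \in [set x | _])) => //= /set_mem h.
    by rewrite mem_set//; apply: h => j.
  - move=> x Ux; have [V VU] := open_agree oU Ux; have [m mV] := Wcofinal V.
    exists m => n mn; rewrite /f indicE mem_set// => y xy; apply: VU => j jV.
    by apply: xy; apply: Wnd mn _ _; exact: mV.
- move=> C mC aC; rewrite (_ : \1_(~` C) = fun x => 1 + (-1) * (\1_C x : R)).
    apply: approximableD; last exact: approximableZ.
    by apply: (@approximable_depends_on [::] _ 1) => // x; rewrite normr1.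
  by apply/funext => x; rewrite mulN1r !indicE in_setC; case: (_ \in _); rewrite ?subrr ?subr0.
move=> F mF tF aF; pose f n : config d A -> R := fun x => \sum_(0 <= k < n) \1_(F k) x.
have fE n x m : F m x -> f n x = (m < n)%:R.
  move=> Fmx; rewrite /f; have F0 (k : nat) : k != m -> (\1_(F k) x : R) = 0.
    move=> km; rewrite indicE memNset// => Fkx; case/eqP: km.
    by apply: tF => //; exists x.
  case: (ltnP m n) => mn.
    by rewrite (bigD1_seq m) ?mem_index_iota ?iota_uniq//= big1 ?addr0 ?indicE ?mem_set//.
  rewrite big_nat_cond big1// => k; rewrite andbT => /andP[_ kn]; apply: F0.
  by rewrite ltn_eqF// (leq_trans kn).
apply: (lim _ f).
- exact: bigcupT_measurable.
- move=> n; exact: approximable_sum.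
- move=> n x; have [[m _ Fmx]|nF] := pselect ((\bigcup_k F k) x).
    rewrite (fE _ _ _ Fmx) indicE mem_set; last by exists m.
    by case: (_ < _)%N; rewrite ?normr1 ?normr0.
  rewrite /f big1 ?normr0; first by have /andP[] := ind01 (\bigcup_k F k) x.
  by move=> k _; rewrite indicE memNset// => Fkx; apply: nF; exists k.
- by move=> x [m _ Fmx]; exists m.+1 => n mn; rewrite (fE _ _ _ Fmx) mn.
Qed.

Lemma approximable_ge0 F : square_int mu F -> (forall x, 0 <= F x) -> approximable F.
Proof.
move=> hF F0; have [mF _] := hF.
have mEF : measurable_fun setT (EFin \o F) by exact/measurable_EFinP.
have EF0 x : [set: config d A] x -> (0 <= (EFin \o F) x)%E by move=> _; rewrite lee_fin.
pose f n : config d A -> R := fun x => nnsfun_approx measurableT mEF n x.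
have f0 n x : 0 <= f n x by exact: fun_ge0.
apply: (approximable_cvg (F_ := f)) => //.
- move=> n; rewrite (_ : f n = fun x =>
    \sum_(y <- finmap.enum_fset (fset_set (range (f n)))) y * \1_(f n @^-1` [set y]) x).
    apply: approximable_sum => y; apply: approximableZ; apply: approximable_indic.
    exact: measurable_funPTI.
  by apply/funext => x; rewrite -fsbig_finite//; exact: fimfunE.
- by move=> x; exact: fine_cvg (cvg_nnsfun_approx measurableT mEF EF0 (I : setT x)).
- move=> n x; rewrite !ger0_norm// -lee_fin /f nnsfun_approxE; exact: le_approx.
Qed.

Lemma square_int_approximable F : square_int mu F -> approximable F.
Proof.
move=> hF; have pos a G : square_int mu G ->
    approximable (fun x => Num.max (a * G x) 0).
  move=> hG; have [mG iG] := square_intZ a hG.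
  apply: approximable_ge0 => [|x]; last by rewrite le_max lexx orbT.
  split; first exact: measurable_maxr.
  apply: (integrable_le _ _ iG).
    by apply: measurable_funX; exact: measurable_maxr.
  by move=> x; rewrite ger0_norm ?sqr_ge0// maxEge; case: ifP => // _;
     rewrite expr0n sqr_ge0.
rewrite (_ : F = fun x => Num.max (1 * F x) 0 + (-1) * Num.max ((-1) * F x) 0).
  by apply: approximableD; [exact: pos|apply: approximableZ; exact: pos].
apply/funext => x; rewrite mul1r !mulN1r !maxEge oppr_ge0.
by case: (leP 0 (F x)); case: (leP (F x) 0); lra.
Qed.

End approx.

End cylinders.

(** * Invariant measures and the energy inequality in L^2 *)

Section invariant.
Variables (d : nat) (A : pointedType) (R : realType).
Variable mu : probability (config d A) R.
Hypothesis mu_inv : invariant_measure mu.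
Implicit Types (x : config d A) (k : 'rV[int]_d) (F G : config d A -> R).

Local Notation shift := Defs.shift.

Lemma integral_shift k (f : config d A -> \bar R) :
  measurable_fun setT f -> (forall x, (0 <= f x)%E) ->
  (\int[mu]_x f (shift k x) = \int[mu]_x f x)%E.
Proof.
move=> mf f0.
transitivity (\int[pushforward mu (shift k)]_y f y)%E.
  by rewrite (ge0_integral_pushforward (measurable_shift k))// preimage_setT.
apply: eq_measure_integral => [|? B mB _]; [exact: measurable_shift|exact: mu_inv].
Qed.

Lemma integrable_shift k F : mu.-integrable setT (EFin \o F) ->
  mu.-integrable setT (EFin \o (fun x => F (shift k x))).
Proof.
move=> /integrableP[/measurable_EFinP mF iF]; apply/integrableP; split.
  by apply/measurable_EFinP; apply: measurableT_comp => //; exact: measurable_shift.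
rewrite (integral_shift k (f := fun x => `|(F x)%:E|%E))//.
by apply: measurableT_comp => //; exact/measurable_EFinP.
Qed.

Lemma Rintegral_shift k F : mu.-integrable setT (EFin \o F) ->
  \int[mu]_x F (shift k x) = \int[mu]_x F x.
Proof.
move=> iF; have /integrableP[mF _] := iF; congr fine.
transitivity (\int[pushforward mu (shift k)]_y (EFin \o F) y)%E.
  rewrite (integral_pushforward (measurable_shift k))// preimage_setT//.
  exact: integrable_shift.
apply: eq_measure_integral => [|? B mB _]; [exact: measurable_shift|exact: mu_inv].
Qed.

Lemma square_int_shift k F : square_int mu F -> square_int mu (fun x => F (shift k x)).
Proof.
move=> [mF iF]; split; last exact: (integrable_shift k iF).
by apply: measurableT_comp => //; exact: measurable_shift.
Qed.

Lemma ip_shift k F G : square_int mu F -> square_int mu G ->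
  ip mu (fun x => F (shift k x)) (fun x => G (shift k x)) = ip mu F G.
Proof.
by move=> hF hG; apply: (Rintegral_shift k (F := fun x => F x * G x));
  exact: square_int_mul.
Qed.

Variables (q : 'rV[int]_d) (S : substitution d A).
Hypothesis q_ge2 : forall i, 2 <= q 0 i.

Lemma square_int_shift_avg n0 N r F : square_int mu F ->
  square_int mu (shift_avg q n0 N r F).
Proof.
move=> hF; apply: square_intZ; apply: square_int_sum => n; exact: square_int_shift.
Qed.

Lemma ip_shift_avg_le n0 N r F : (0 < N)%N -> square_int mu F ->
  ip mu (shift_avg q n0 N r F) (shift_avg q n0 N r F) <= ip mu F F.
Proof.
move=> N0 hF; have N0' : 0 < N%:R :> R by rewrite ltr0n.
pose f n x := F (shift (scale q n0 (carry_freq q r n)) x).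
have hf n : square_int mu (f n) by exact: square_int_shift.
have hs := square_int_sum (index_iota N (N + N)) hf.
have -> : ip mu (shift_avg q n0 N r F) (shift_avg q n0 N r F) = N%:R^-1 *
    (N%:R^-1 * ip mu (fun x => \sum_(N <= n < N + N) f n x)
                     (fun x => \sum_(N <= n < N + N) f n x)).
  by rewrite -(ipZl _ hs hs) [X in _ * X]ipC -(ipZl _ hs (square_intZ _ hs)).
apply: le_trans (ler_wpM2l _ (ler_wpM2l _ (ip_sum_le _ hf))) _; rewrite ?invr_ge0//.
rewrite (eq_bigr (fun=> ip mu F F)); last by move=> n _; exact: ip_shift.
rewrite big_const_seq count_predT iter_addr_0 size_iota addnK -[ip mu F F *+ _]mulr_natl.
by rewrite !mulKf ?gt_eqF.
Qed.

Hypothesis d_gt0 : (0 < d)%N.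
Hypothesis A_finite : finite_set [set: A].
Hypothesis S_bij : bijective_subst q S.
Hypothesis S_comm : commutative_subst q S.
Hypothesis mu_S : mu (subst_shift q S) = 1%E.

Local Notation digits := (digits q_ge2).
Local Notation Q := ((size digits)%:R : R).

(** By invariance a function and its orbit averages have the same integral, so a pointwise bound on
    the latter is enough. *)
Lemma Rintegral_orbit_ge H W l (e C : R) : depends_on W H ->
  (forall x, `|H x| <= C) ->
  (forall x, subst_shift q S x -> - e <= avg (boxseq q_ge2 l) (fun t => H (shift t x))) ->
  - e <= \int[mu]_x H x.
Proof.
move=> WH HC He; have mX := measurable_subst_shift q S.
have mH := depends_on_measurable_fun WH.
have iH : mu.-integrable setT (EFin \o H).
  apply: (@integrable_le _ _ _ _ _ (fun=> C)) => //; exact: finite_measure_integrable_cst.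
pose f x := avg (boxseq q_ge2 l) (fun t => H (shift t x)).
pose N := ~` subst_shift q S; have mN : measurable N by exact: measurableC.
have N0 : mu N = 0%E.
  by rewrite probability_setC// mu_S subee.
have C0 : 0 <= C by exact: le_trans (HC point).
have fC x : `|f x| <= C.
  rewrite -[leRHS](@avg_const _ _ (boxseq q_ge2 l) C (size_boxseq_gt0 q_ge2 l)).
  by apply: le_trans (ler_norm_avg _ _) _; apply: ler_avg => t _.
have iHt t : mu.-integrable setT (EFin \o (fun x => H (shift t x))).
  exact: integrable_shift.
have iS := integrable_sumr (boxseq q_ge2 l) iHt.
have -> : \int[mu]_x H x = \int[mu]_x f x.
  rewrite RintegralZl//.
  rewrite Rintegral_sum//; under [in RHS]eq_bigr do rewrite Rintegral_shift//.
  by rewrite -[RHS]/(avg _ _) avg_const// size_boxseq_gt0.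
have iN : mu.-integrable setT (EFin \o (\1_N : _ -> R)) by exact: integrable_indic.
have IN : \int[mu]_x (\1_N x : R) = 0.
  by rewrite /Rintegral integral_indic// setIT; exact: (congr1 fine N0).
have iE : mu.-integrable setT (EFin \o (fun=> - e)) by exact: finite_measure_integrable_cst.
have iCN : mu.-integrable setT (EFin \o (fun x => (- (C + `|e|)) * (\1_N x : R))).
  exact: (integrableZl measurableT _ iN).
(* The measure lives on the full shift: off the subshift, a null set, the lower bound is dropped by
   C + |e|, which brings it below -C and hence below any value of [f]. *)
have -> : - e = \int[mu]_x (- e + (- (C + `|e|)) * (\1_N x : R)).
  rewrite RintegralD// RintegralZl// IN mulr0 addr0 Rintegral_cst//.
  by rewrite -[LHS]mulr1; congr (_ * _); exact: (esym (congr1 fine (probability_setT mu))).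
apply: le_Rintegral => //.
- exact: (integrableD measurableT iE iCN).
- exact: (integrableZl measurableT _ iS).
move=> x _; have [xX|xX] := pselect (subst_shift q S x).
  by rewrite indicE memNset ?mulr0 ?addr0; [exact: He|exact].
rewrite indicE mem_set// mulr1; have := fC x; have := ler_norm (- e); rewrite normrN.
by rewrite ler_norml => h /andP[h1 _]; rewrite -/(f x); lra.
Qed.

Lemma energy_integral G W (e : R) : 0 < e -> depends_on W G -> (forall x, `|G x| <= 1) ->
  exists n1 K1, forall n0 K, (n1 <= n0)%N -> (K1 <= K)%N -> (0 < K)%N ->
    ip mu G G <= 3 * Q ^+ 2 * \sum_(r <- digits)
      ip mu (shift_avg q n0 (K ^ 2) r G) (shift_avg q n0 (K ^ 2) r G) + e.
Proof.
move=> e0 WG G1; have e2 : 0 < e / 2 by lra.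
have [n1 [K1 block]] := block_energy q_ge2 A_finite S_bij S_comm e2 WG G1.
exists n1, K1 => n0 K n10 K1K K0; have [b Hb] := block n0 K n10 K1K K0.
have WH := @energy_depends_on _ _ _ q_ge2 R n0 (K ^ 2) G W WG.
have HC x := energy_le q_ge2 n0 (K ^ 2) x G1.
have [l Hl] := orbit_average d_gt0 e2 WH HC Hb.
have := Rintegral_orbit_ge WH HC Hl.
have -> : 2 * (e / 2) = e by lra.
have hG : square_int mu G := depends_on_square_int mu WG G1.
pose s r := shift_avg q n0 (K ^ 2) r G.
have hs r : square_int mu (s r) by exact: square_int_shift_avg.
have iS := integrable_sumr digits (fun r => (hs r).2).
rewrite RintegralB//; last first.
- exact: hG.2.
- exact: (integrableZl measurableT _ iS).
rewrite RintegralZl// -/(ip mu G G) (Rintegral_sum _ (fun r => (hs r).2)).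
under eq_bigr do rewrite -[\int[mu]_x _]/(ip mu (s _) (s _)).
by rewrite -/(s _); lra.
Qed.

Lemma energy_L2 F (e : R) : 0 < e -> square_int mu F ->
  exists n1 K1, forall n0 K, (n1 <= n0)%N -> (K1 <= K)%N -> (0 < K)%N ->
    ip mu F F <= 12 * Q ^+ 2 * \sum_(r <- digits)
      ip mu (shift_avg q n0 (K ^ 2) r F) (shift_avg q n0 (K ^ 2) r F) + e.
Proof.
move=> e0 hF; have Q1 : 1 <= Q by exact: Q_ge1.
have Q3 : 0 < 12 * Q ^+ 3 + 4 by rewrite ltr_wpDl// mulr_ge0// exprn_ge0.
(* The error is 2 dl from [h1], 2 dl from doubling [H1], and 12 Q^3 dl from [h3]. *)
pose dl := e / (12 * Q ^+ 3 + 4); have dl0 : 0 < dl by rewrite divr_gt0.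
have [_ /(_ dl dl0)[W [G [C [WG GC GF]]]]] := square_int_approximable hF.
pose B := Num.max C 1; have B0 : 0 < B by rewrite lt_max ltr01 orbT.
pose G' x := B^-1 * G x.
have WG' : depends_on W G' by move=> x y xy; rewrite /G' (WG x y).
have G'1 x : `|G' x| <= 1.
  have Bn : `|B^-1| = B^-1 by rewrite ger0_norm// invr_ge0 ltW.
  by rewrite /G' normrM Bn mulrC ler_pdivrMr// mul1r le_max GC.
have hG := depends_on_square_int mu WG GC.
(* The inequality for local functions asks for the bound 1, so G is divided by [B] and the tolerance
   by its square. *)
have dB : 0 < dl / B ^+ 2 by rewrite divr_gt0// exprn_gt0.
have [n1 [K1 H]] := energy_integral dB WG' G'1.
exists n1, K1 => n0 K n10 K1K K0; have := H n0 K n10 K1K K0.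
set N := (K ^ 2)%N; have N0 : (0 < N)%N by rewrite expn_gt0 K0.
have saE r : shift_avg q n0 N r G' = fun x => B^-1 * shift_avg q n0 N r G x.
  by apply/funext => x; rewrite /shift_avg /G' -mulr_sumr mulrCA.
have sZ r := square_int_shift_avg n0 N r hG.
have ipE g : square_int mu g -> ip mu (fun x => B^-1 * g x) (fun x => B^-1 * g x) =
    (B ^+ 2)^-1 * ip mu g g.
  move=> hg; rewrite (ipZl _ hg (square_intZ _ hg)) ipC (ipZl _ hg hg).
  by rewrite mulrA -expr2 exprVn.
under eq_bigr do rewrite saE ipE//.
rewrite {1}/G' ipE// -mulr_sumr => H1.
have {}H1 : ip mu G G <= 3 * Q ^+ 2 * \sum_(r <- digits)
    ip mu (shift_avg q n0 N r G) (shift_avg q n0 N r G) + dl.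
  have B2 : 0 < (B ^+ 2)^-1 by rewrite invr_gt0 exprn_gt0.
  by rewrite -(ler_pM2l B2) mulrDr mulrCA [_ * dl]mulrC.
have hFG := square_intB hF hG.
have h1 : ip mu F F <= 2 * ip mu G G + 2 * dl.
  have E : F = (fun x => G x + (F x - G x)) by apply/funext => x; rewrite addrC subrK.
  rewrite {1 2}E; apply: le_trans (ip_add_le hG hFG) _; lra.
have h2 r : ip mu (shift_avg q n0 N r G) (shift_avg q n0 N r G) <=
    2 * ip mu (shift_avg q n0 N r F) (shift_avg q n0 N r F) + 2 * dl.
  have hGF : square_int mu (fun x => (-1) * (F x - G x)) by exact: square_intZ.
  have E : shift_avg q n0 N r G = (fun x => shift_avg q n0 N r F x +
      shift_avg q n0 N r (fun x => (-1) * (F x - G x)) x).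
    apply/funext => x; rewrite /shift_avg -mulrDr -big_split/=; congr (_ * _).
    by apply: eq_bigr => n _; rewrite mulN1r opprB addrC subrK.
  rewrite E; apply: le_trans (ip_add_le _ _) _; try exact: square_int_shift_avg.
  rewrite lerD2l ler_wpM2l//; apply: (le_trans (ip_shift_avg_le n0 r N0 hGF)).
  by rewrite (ipZl _ hFG hGF) ipC (ipZl _ hFG hFG) mulrA mulrNN !mul1r.
have h3 : \sum_(r <- digits) ip mu (shift_avg q n0 N r G) (shift_avg q n0 N r G) <=
    2 * \sum_(r <- digits) ip mu (shift_avg q n0 N r F) (shift_avg q n0 N r F) +
    Q * (2 * dl).
  apply: le_trans (ler_sum _ (fun r _ => h2 r)) _.
  rewrite big_split/= mulr_sumr lerD2l big_const_seq count_predT iter_addr_0.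
  by rewrite -[(_ * dl) *+ _]mulr_natl.
move: h3; set X := \sum_(r <- _) _ in H1 *; set Y := \sum_(r <- _) _ => h3.
have eE : e = 12 * Q ^+ 3 * dl + 4 * dl by rewrite /dl -mulrDl mulrC divfK// gt_eqF.
have Q2 : 0 <= 6 * Q ^+ 2 by rewrite mulr_ge0// exprn_ge0.
have := ler_wpM2l Q2 h3; rewrite eE => h4.
by move: h1 H1 h4; clear; set a := ip _ _ _; set b := ip _ _ _; lra.
Qed.

End invariant.

(** * Characters of the torus *)

Section circle.
Variable R : realType.
Implicit Types (t : R) (z w : R[i]) (k : int).

Lemma complex_ReM z w : complex.Re (z * w) =
  complex.Re z * complex.Re w - complex.Im z * complex.Im w.
Proof. by case: z => a b; case: w. Qed.

Lemma complex_ImM z w : complex.Im (z * w) =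
  complex.Re z * complex.Im w + complex.Im z * complex.Re w.
Proof. by case: z => a b; case: w. Qed.

Definition cis t : R[i] := Complex (cos t) (sin t).

Lemma cisD s t : cis (s + t) = cis s * cis t.
Proof.
apply/eqP; rewrite eq_complex /= cosD sinD eqxx /=.
by apply/eqP; ring.
Qed.

Lemma cis0 : cis 0 = 1.
Proof. by rewrite /cis cos0 sin0. Qed.

Lemma cisX t n : cis t ^+ n = cis (t * n%:R).
Proof.
elim: n => [|n IH]; first by rewrite mulr0 cis0.
by rewrite exprSr IH -cisD; congr cis; rewrite -[in RHS]natr1 mulrDr mulr1.
Qed.

Lemma cisN t : (cis t)^-1 = cis (- t).
Proof.
have h : cis t * cis (- t) = 1 by rewrite -cisD subrr cis0.
have t0 : cis t != 0.
  by apply: contra_eq_neq h => ->; rewrite mul0r eq_sym oner_eq0.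
by apply: (mulfI t0); rewrite h divff.
Qed.

Lemma cisXz t k : cis t ^ k = cis (t * k%:~R).
Proof.
case: k => n; first by rewrite -exprnP cisX.
by rewrite NegzE -exprnN -exprVn cisN cisX mulrNz mulrN mulNr.
Qed.

Lemma cis_2pi : cis (2 * pi) = 1.
Proof. by rewrite /cis mulr_natl cos2pi sin2pi. Qed.

Lemma cis_2pi_int k : cis (2 * pi * k%:~R) = 1.
Proof. by rewrite -cisXz cis_2pi exp1rz. Qed.

Lemma integral_uniform_period (f F : R -> R) : continuous f ->
  (forall t, `|f t| <= 1) -> (forall t, is_derive t 1 F (f t)) -> F 0 = F 1 ->
  \int[uniform_prob (@ltr01 R)]_t f t = 0.
Proof.
move=> cf f1 dF F01.
have mf : measurable_fun setT f by exact: continuous_measurable_fun.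
have i_f : (uniform_prob (@ltr01 R)).-integrable setT (EFin \o f).
  apply: (@integrable_le _ _ _ (uniform_prob (@ltr01 R)) _ (fun=> 1)) => //.
  exact: finite_measure_integrable_cst.
have i_1 : (uniform_prob (@ltr01 R)).-integrable setT (EFin \o (fun=> 1)).
  exact: finite_measure_integrable_cst.
(* Adding 1 makes the integrand nonnegative, so that the integral against the uniform law becomes
   one over [0, 1] and the fundamental theorem of calculus applies. *)
suff : \int[uniform_prob (@ltr01 R)]_t (f t + 1) = 1.
  rewrite RintegralD// Rintegral_cst// mul1r.
  have -> : fine (uniform_prob (@ltr01 R) setT) = 1 by rewrite probability_setT.
  by lra.
rewrite /Rintegral integral_uniform; first last.
- by move=> t; rewrite lee_fin; have := f1 t; rewrite ler_norml => /andP[]; lra.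
- by apply/measurable_EFinP; exact: measurable_funD.
rewrite subr0 invr1 mul1e (@continuous_FTC2 _ (fun t => f t + 1) (fun t => F t + t))//.
- by rewrite -EFinB /= -F01; lra.
- by apply: continuous_subspaceT => t; apply: cvgD; [exact: cf|exact: cvg_cst].
- have cG : continuous (fun t => F t + t).
    move=> t; apply: cvgD; last exact: cvg_id.
    by apply: differentiable_continuous; apply/derivable1_diffP; exact: ex_derive.
  split => [t _||].
  + by apply: derivableD => //; exact: ex_derive.
  + by apply: cvg_at_right_filter; exact: cG.
  + by apply: cvg_at_left_filter; exact: cG.
- move=> t _; rewrite derive1E; apply: derive_val.
Qed.

Lemma circle_lebesgue_integral (f : circle R -> R) (g G : R -> R) (C : R) :
  measurable_fun setT f -> (forall x, `|f x| <= C) ->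
  (forall t, f (circle_param t) = g t) -> continuous g ->
  (forall t, `|g t| <= 1) -> (forall t, is_derive t 1 G (g t)) -> G 0 = G 1 ->
  \int[circle_lebesgue R]_z f z = 0.
Proof.
move=> mf fC fg cg g1 dG G01; rewrite -(integral_uniform_period cg g1 dG G01).
rewrite /Rintegral; congr fine.
transitivity (\int[uniform_prob (@ltr01 R)]_t ((EFin \o f) \o @circle_param R) t)%E;
  last by apply: eq_integral => t _ /=; rewrite fg.
apply: (integral_distribution (X := @circle_param R)); first exact/measurable_EFinP.
apply: (@integrable_le _ _ _ (uniform_prob (@ltr01 R)) _ (fun=> C)).
- by apply: measurableT_comp => //; exact: measurable_circle_param.
- by move=> x; exact: fC.
- exact: finite_measure_integrable_cst.
Qed.

Lemma is_derive_scale (a t : R) : is_derive t 1 (fun t : R => a * t) a.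
Proof.
have h : is_derive t 1 (a \*: (@id R)) (a *: 1) by exact: is_deriveZ.
by rewrite -[X in is_derive _ _ _ X]mulr1; exact: h.
Qed.

Lemma is_derive_sin_scale (a t : R) : a != 0 ->
  is_derive t 1 (fun t => a^-1 * sin (a * t)) (cos (a * t)).
Proof.
move=> a0.
have h := is_derive1_comp (is_derive_sin (a * t)) (is_derive_scale a t).
have : is_derive t 1 (a^-1 \*: (sin \o (fun t => a * t))) (a^-1 *: (cos (a * t) * a)) by exact: is_deriveZ.
by rewrite /GRing.scale /= mulrC mulfK.
Qed.

Lemma is_derive_cos_scale (a t : R) : a != 0 ->
  is_derive t 1 (fun t => - a^-1 * cos (a * t)) (sin (a * t)).
Proof.
move=> a0.
have h := is_derive1_comp (is_derive_cos (a * t)) (is_derive_scale a t).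
have : is_derive t 1 ((- a^-1) \*: (cos \o (fun t => a * t)))
  ((- a^-1) *: (- sin (a * t) * a)) by exact: is_deriveZ.
by rewrite /GRing.scale /= !mulNr mulrN opprK mulrC mulfK.
Qed.

Lemma val_circle_param (t : R) : val (circle_param t) = cis (2 * pi * t).
Proof. by []. Qed.

Lemma circle_sqr (z : circle R) :
  complex.Re (val z) ^+ 2 + complex.Im (val z) ^+ 2 = 1.
Proof.
case: z => z /= z1; have := z1; rewrite normc_def => /eqP[] h.
rewrite -[LHS]sqr_sqrtr ?addr_ge0 ?sqr_ge0// h expr1n//.
Qed.

Lemma measurable_circle_Re : measurable_fun setT (fun z : circle R => complex.Re (val z)).
Proof.
suff : measurable_fun setT (@circle_coords R) by move/measurable_fun_pairP => [].
by move=> _ B mB; rewrite setTI; exists B => //; rewrite setTI.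
Qed.

Lemma measurable_circle_Im : measurable_fun setT (fun z : circle R => complex.Im (val z)).
Proof.
suff : measurable_fun setT (@circle_coords R) by move/measurable_fun_pairP => [].
by move=> _ B mB; rewrite setTI; exists B => //; rewrite setTI.
Qed.

Definition cmeasurable d (T : measurableType d) (f : T -> R[i]) :=
  measurable_fun setT (fun x => complex.Re (f x)) /\
  measurable_fun setT (fun x => complex.Im (f x)).

Lemma cmeasurable_cst d (T : measurableType d) (c : R[i]) :
  cmeasurable (fun _ : T => c).
Proof. by split; exact: measurable_cst. Qed.

Lemma cmeasurableM d (T : measurableType d) (f g : T -> R[i]) :
  cmeasurable f -> cmeasurable g -> cmeasurable (fun x => f x * g x).
Proof.
move=> [fr fi] [gr gi]; split.
  under eq_fun do rewrite complex_ReM.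
  by apply: measurable_funB; exact: measurable_funM.
under eq_fun do rewrite complex_ImM.
by apply: measurable_funD; exact: measurable_funM.
Qed.

Lemma cmeasurable_prod d (T : measurableType d) (I : Type) (s : seq I)
  (f : I -> T -> R[i]) : (forall i, cmeasurable (f i)) ->
  cmeasurable (fun x => \prod_(i <- s) f i x).
Proof.
move=> mf; elim: s => [|i s IH].
  by under eq_fun do rewrite big_nil; exact: cmeasurable_cst.
by under eq_fun do rewrite big_cons; exact: cmeasurableM.
Qed.

Lemma circle_inv (z : circle R) : (val z)^-1 = conjc (val z).
Proof.
have := circle_sqr z; case: (val z) => a b /= ab.
by rewrite /GRing.inv /= ab !divr1.
Qed.

Lemma circle_exprN (z : circle R) n : val z ^- n = conjc (val z ^+ n).
Proof. by rewrite -exprVn circle_inv rmorphXn. Qed.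

Lemma cmeasurable_circle_exp k : cmeasurable (fun z : circle R => val z ^ k).
Proof.
have nat_case n : cmeasurable (fun z : circle R => val z ^+ n).
  elim: n => [|n IH]; first exact: cmeasurable_cst.
  under eq_fun do rewrite exprS; apply: cmeasurableM => //.
  by split; [exact: measurable_circle_Re|exact: measurable_circle_Im].
case: k => n; first exact: nat_case.
have [mr mi] := nat_case n.+1; split.
  rewrite (_ : (fun _ => _) = (fun z : circle R => complex.Re (val z ^+ n.+1))) //.
  by apply/funext => z; rewrite NegzE -exprnN circle_exprN; case: (_ ^+ _).
rewrite (_ : (fun _ => _) = (fun z : circle R => - complex.Im (val z ^+ n.+1))).
  exact: measurable_funN.
by apply/funext => z; rewrite NegzE -exprnN circle_exprN; case: (_ ^+ _).
Qed.

Lemma sqr_norm1 (z : R[i]) : `|z| = 1 ->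
  `|complex.Re z| <= 1 /\ `|complex.Im z| <= 1.
Proof.
rewrite normc_def => /eqP; rewrite eq_complex => /andP[/eqP /= h _].
have h2 : complex.Re z ^+ 2 + complex.Im z ^+ 2 = 1.
  by rewrite -[LHS]sqr_sqrtr ?addr_ge0 ?sqr_ge0// h expr1n.
split; rewrite -(@expr_le1 _ 2)// real_normK ?num_real// -h2.
  by rewrite lerDl sqr_ge0.
by rewrite lerDr sqr_ge0.
Qed.

Lemma circle_exp_norm (z : circle R) k : `|val z ^ k| = 1.
Proof.
have h n : `|val z ^+ n| = 1 by rewrite normrX (eqP (valP z)) expr1n.
by case: k => n; [exact: h|rewrite NegzE -exprnN normrV ?h ?invr1// unitfE -normr_gt0 h].
Qed.

Lemma circle_exp_integral k : k != 0 ->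
  \int[circle_lebesgue R]_z complex.Re (val z ^ k) = 0 /\
  \int[circle_lebesgue R]_z complex.Im (val z ^ k) = 0.
Proof.
move=> k0; have [mr mi] := cmeasurable_circle_exp k.
pose a : R := 2 * pi * k%:~R.
have a0 : a != 0 by rewrite !mulf_neq0 ?intr_eq0// gt_eqF// pi_gt0.
have E (t : R) : val (circle_param t) ^ k = cis (a * t).
  by rewrite val_circle_param cisXz; congr cis; rewrite /a mulrAC.
have ca : continuous (fun t : R => a * t) by exact: mulrl_continuous.
have [ca1 sa1] : cos a = 1 /\ sin a = 0 by have := cis_2pi_int k => -[].
split.
- apply: (@circle_lebesgue_integral _ (fun t => cos (a * t)) _ 1 mr _ _ _ _
    (fun t => is_derive_sin_scale t a0)).
  + by move=> z; apply: (sqr_norm1 (circle_exp_norm z k)).1.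
  + by move=> t; rewrite E.
  + move=> t; apply: (@continuous_comp _ _ _ (fun t : R => a * t) (@cos R)); first exact: ca.
    exact: continuous_cos.
  + by move=> t; rewrite ler_norml cos_geN1 cos_le1.
  + by rewrite mulr0 mulr1 sin0 sa1.
- apply: (@circle_lebesgue_integral _ (fun t => sin (a * t)) _ 1 mi _ _ _ _
    (fun t => is_derive_cos_scale t a0)).
  + by move=> z; apply: (sqr_norm1 (circle_exp_norm z k)).2.
  + by move=> t; rewrite E.
  + move=> t; apply: (@continuous_comp _ _ _ (fun t : R => a * t) (@sin R)); first exact: ca.
    exact: continuous_sin.
  + by move=> t; rewrite ler_norml sin_geN1 sin_le1.
  + by rewrite mulr0 mulr1 cos0 ca1.
Qed.

End circle.

(** * Characters under the Lebesgue measure of the torus *)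

Section torus.
Variable R : realType.

Lemma bounded_integrable d (T : measurableType d)
    (m : {finite_measure set T -> \bar R}) (f : T -> R) C :
  measurable_fun setT f -> (forall x, `|f x| <= C) ->
  m.-integrable setT (EFin \o f).
Proof.
move=> mf fC; apply: (integrable_le mf fC); exact: finite_measure_integrable_cst.
Qed.

Lemma integral_circle_product d (P : probability (torus R d) R)
    (f : circle R -> R) (g : torus R d -> R) B C :
  measurable_fun setT f -> (forall z, `|f z| <= B) ->
  measurable_fun setT g -> (forall z, `|g z| <= C) ->
  \int[circle_product P]_z (f z.1 * g z.2) =
  \int[circle_lebesgue R]_z f z * \int[P]_z g z.
Proof.
move=> mf fB mg gC.
have i_f := bounded_integrable (circle_lebesgue R) mf fB.
have ig := bounded_integrable P mg gC.
have mfg : measurable_fun setT (fun z : circle R * torus R d => f z.1 * g z.2).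
  by apply: measurable_funM; apply: measurableT_comp.
have ifg : (circle_product P).-integrable setT (EFin \o (fun z => f z.1 * g z.2)).
  apply: (@bounded_integrable _ _ _ _ (B * C) mfg) => z.
  by rewrite normrM ler_pM.
have gfin : (\int[P]_z (g z)%:E)%E = (\int[P]_z g z)%:E.
  by rewrite fineK//; exact: integrable_fin_num.
rewrite {1}/Rintegral -(integral12_prod_meas1 ifg) /fubini_F /=.
under eq_integral => z _.
  rewrite (_ : (\int[P]_y (f z * g y)%:E)%E = ((f z) * \int[P]_z g z)%:E).
    over.
  by under eq_integral do rewrite EFinM; rewrite integralZl// gfin.
exact: RintegralZr.
Qed.

Lemma torus_charE d (k : 'rV[int]_d.+1) (z : circle R) (w : torus R d) :
  torus_char k (torus_cons (z, w)) =
  val z ^ k 0 0 * torus_char (\row_i k 0 (lift ord0 i)) w.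
Proof.
rewrite /torus_char big_ord_recl; congr (_ * _).
by apply: eq_bigr => i _; rewrite mxE /= tnthS.
Qed.

Lemma cmeasurable_torus_char d (k : 'rV[int]_d) :
  cmeasurable (fun z : torus R d => torus_char k z).
Proof.
apply: cmeasurable_prod => i; have [mr mi] := cmeasurable_circle_exp R (k 0 i).
by split; apply: (@measurableT_comp _ _ _ _ _ _ (fun z : circle R => _ (val z ^ k 0 i))
  _ (fun z : torus R d => tnth z i)) => //; exact: measurable_tnth.
Qed.

Lemma torus_char_norm d (k : 'rV[int]_d) (z : torus R d) : `|torus_char k z| = 1.
Proof.
rewrite /torus_char normr_prod big1// => i _; exact: circle_exp_norm.
Qed.

Lemma torus_char_Re_le1 d (k : 'rV[int]_d) (z : torus R d) :
  `|complex.Re (torus_char k z)| <= 1.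
Proof. exact: (sqr_norm1 (torus_char_norm k z)).1. Qed.

Lemma torus_char_Im_le1 d (k : 'rV[int]_d) (z : torus R d) :
  `|complex.Im (torus_char k z)| <= 1.
Proof. exact: (sqr_norm1 (torus_char_norm k z)).2. Qed.

Lemma torus_char0 d (z : torus R d) : torus_char 0 z = 1.
Proof. by rewrite /torus_char big1// => i _; rewrite mxE expr0z. Qed.

Lemma circle_neq0 (z : circle R) : val z != 0.
Proof. by rewrite -normr_gt0 (eqP (valP z)). Qed.

Lemma torus_charD d (k l : 'rV[int]_d) (z : torus R d) :
  torus_char (k + l) z = torus_char k z * torus_char l z.
Proof.
rewrite /torus_char -big_split; apply: eq_bigr => i _.
by rewrite mxE expfzDr// circle_neq0.
Qed.

Lemma torus_charN d (k : 'rV[int]_d) (z : torus R d) :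
  torus_char (- k) z = conjc (torus_char k z).
Proof.
rewrite /torus_char rmorph_prod; apply: eq_bigr => i _; rewrite mxE.
case: (k 0 i) => n; first by rewrite -exprnN circle_exprN.
by rewrite NegzE opprK -[in RHS]exprnN circle_exprN; symmetry; exact: conjcK.
Qed.

(** Fubini and induction on d: either the first exponent is nonzero and the circle integrals vanish,
    or the remaining exponents are not all zero. *)
Lemma torus_char_integral d (k : 'rV[int]_d) : k != 0 ->
  \int[torus_lebesgue R d]_z complex.Re (torus_char k z) = 0 /\
  \int[torus_lebesgue R d]_z complex.Im (torus_char k z) = 0.
Proof.
elim: d k => [|d IH] k k0; first by rewrite (thinmx0 k) eqxx in k0.
pose P := torus_lebesgue R d; pose k' : 'rV[int]_d := \row_i k 0 (lift ord0 i).
have step (h : R[i] -> R) : measurable_fun setT (fun z => h (torus_char k z)) ->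
    (forall z : torus R d.+1, `|h (torus_char k z)| <= 1) ->
    \int[torus_lebesgue R d.+1]_z h (torus_char k z) =
    \int[circle_product P]_z h (val z.1 ^ k 0 0 * torus_char k' z.2).
  move=> mh h1; rewrite /Rintegral; congr fine.
  transitivity (\int[circle_product P]_z
      ((EFin \o (fun z : torus R d.+1 => h (torus_char k z))) \o @torus_cons R d) z)%E.
    apply: (integral_distribution (X := @torus_cons R d)); first exact/measurable_EFinP.
    apply: (@bounded_integrable _ _ (circle_product P)
      (fun z => h (torus_char k (torus_cons z))) 1).
      exact: (measurableT_comp mh (@measurable_torus_cons R d)).
    by move=> z; exact: h1.
  by apply: eq_integral => -[z w] _ /=; rewrite torus_charE.
have [mr mi] := cmeasurable_torus_char k.
have [mr' mi'] := cmeasurable_torus_char k'.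
have [cr ci] := cmeasurable_circle_exp R (k 0 0).
have r1 (z : circle R) := (sqr_norm1 (circle_exp_norm z (k 0 0))).1.
have i1 (z : circle R) := (sqr_norm1 (circle_exp_norm z (k 0 0))).2.
have pr (f : circle R -> R) (g : torus R d -> R) :
    measurable_fun setT f -> measurable_fun setT g ->
    (forall z, `|f z| <= 1) -> (forall z, `|g z| <= 1) ->
    (circle_product P).-integrable setT (EFin \o (fun z => f z.1 * g z.2)).
  move=> mf mg f1 g1; apply: (@bounded_integrable _ _ _ _ 1) => [|z].
    by apply: measurable_funM; apply: measurableT_comp.
  by rewrite normrM mulr_ile1.
rewrite !step//; first last.
- exact: torus_char_Re_le1.
- exact: torus_char_Im_le1.
have -> : \int[circle_product P]_z complex.Re (val z.1 ^ k 0 0 * torus_char k' z.2) =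
   \int[circle_product P]_z (complex.Re (val z.1 ^ k 0 0) * complex.Re (torus_char k' z.2)
   - complex.Im (val z.1 ^ k 0 0) * complex.Im (torus_char k' z.2)).
  by apply: eq_Rintegral => z _; rewrite complex_ReM.
have -> : \int[circle_product P]_z complex.Im (val z.1 ^ k 0 0 * torus_char k' z.2) =
   \int[circle_product P]_z (complex.Re (val z.1 ^ k 0 0) * complex.Im (torus_char k' z.2)
   + complex.Im (val z.1 ^ k 0 0) * complex.Re (torus_char k' z.2)).
  by apply: eq_Rintegral => z _; rewrite complex_ImM.
have r1' := torus_char_Re_le1 k'; have i1' := torus_char_Im_le1 k'.
rewrite (RintegralB measurableT (pr _ _ cr mr' r1 r1') (pr _ _ ci mi' i1 i1')).
rewrite (RintegralD measurableT (pr _ _ cr mi' r1 i1') (pr _ _ ci mr' i1 r1')).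
rewrite (integral_circle_product P cr r1 mr' r1') (integral_circle_product P ci i1 mi' i1').
rewrite (integral_circle_product P cr r1 mi' i1') (integral_circle_product P ci i1 mr' r1').
have [k00|k00] := eqVneq (k 0 0) 0; last first.
  by have [-> ->] := circle_exp_integral R k00; rewrite !mul0r subr0 addr0.
have k'0 : k' != 0.
  apply: contra_neq k0 => /rowP e; apply/rowP => i; rewrite mxE.
  have [j ->|->] := unliftP ord0 i; [by have := e j; rewrite !mxE|exact: k00].
by have [-> ->] := IH k' k'0; rewrite !mulr0 subr0 addr0.
Qed.

End torus.

(** * Trigonometric polynomials and spectral measures *)

Section trigpoly.
Variables (R : realType) (d : nat).

(* Real trigonometric polynomials as lists of (coefficient, frequency). *)
Definition tpoly := seq (R * 'rV[int]_d).
Implicit Types (w v : tpoly) (z : torus R d).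

Definition tev w z : R[i] := \sum_(p <- w) Complex p.1 0 * torus_char p.2 z.

Definition tmul w v : tpoly := [seq (a.1 * b.1, a.2 + b.2) | a <- w, b <- v].

Definition tstar w : tpoly := [seq (a.1, - a.2) | a <- w].

Lemma tev_mul w v z : tev (tmul w v) z = tev w z * tev v z.
Proof.
rewrite /tev big_allpairs_dep mulr_suml; apply: eq_bigr => a _.
rewrite mulr_sumr; apply: eq_bigr => b _; rewrite torus_charD /=.
have -> : Complex (a.1 * b.1) 0 = Complex a.1 0 * Complex b.1 0 :> R[i].
  by apply/eqP; rewrite eq_complex /= !mul0r !mulr0 subr0 addr0 !eqxx.
by rewrite mulrACA.
Qed.

Lemma tev_cat w v z : tev (w ++ v) z = tev w z + tev v z.
Proof. exact: big_cat. Qed.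

Lemma tev_star w z : tev (tstar w) z = conjc (tev w z).
Proof.
rewrite /tev big_map rmorph_sum; apply: eq_bigr => a _ /=.
rewrite torus_charN rmorphM /=; congr (_ * _).
by apply/eqP; rewrite eq_complex /= oppr0 !eqxx.
Qed.

Lemma complex_ReD (x y : R[i]) : complex.Re (x + y) = complex.Re x + complex.Re y.
Proof. by case: x; case: y. Qed.

Lemma tev_Re w z : complex.Re (tev w z) = \sum_(p <- w) p.1 * complex.Re (torus_char p.2 z).
Proof.
elim: w => [|p w IH]; first by rewrite /tev !big_nil.
rewrite /tev !big_cons complex_ReD complex_ReM -IH; congr (_ + _) => /=.
by rewrite mul0r subr0.
Qed.

Definition tsqr w z : R := complex.Re (tev w z) ^+ 2 + complex.Im (tev w z) ^+ 2.

Lemma tsqr_ge0 w z : 0 <= tsqr w z.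
Proof. by rewrite addr_ge0 ?sqr_ge0. Qed.

Lemma mul_conjc (x : R[i]) :
  x * conjc x = Complex (complex.Re x ^+ 2 + complex.Im x ^+ 2) 0.
Proof.
case: x => a b; apply/eqP; rewrite eq_complex /= mulrN opprK -!expr2 eqxx /=.
by rewrite mulrN mulrC addNr.
Qed.

Lemma tev_mul_star w z : tev (tmul w (tstar w)) z = Complex (tsqr w z) 0.
Proof. by rewrite tev_mul tev_star mul_conjc. Qed.

Lemma tsqr_mul w v z : tsqr (tmul w v) z = tsqr w z * tsqr v z.
Proof.
rewrite /tsqr tev_mul complex_ReM complex_ImM; ring.
Qed.

Lemma tsqrE w z : tsqr w z = complex.Re (tev (tmul w (tstar w)) z).
Proof. by rewrite tev_mul_star. Qed.

Lemma measurable_tev_Re w : measurable_fun setT (fun z => complex.Re (tev w z)).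
Proof.
under eq_fun do rewrite tev_Re.
apply: measurable_sum => p; apply: measurable_funM => //.
exact: (cmeasurable_torus_char R p.2).1.
Qed.

Lemma tev_Re_le w z : `|complex.Re (tev w z)| <= \sum_(p <- w) `|p.1|.
Proof.
rewrite tev_Re; apply: le_trans (ler_norm_sum _ _ _) _; apply: ler_sum => p _.
by rewrite normrM -[leRHS]mulr1 ler_wpM2l// torus_char_Re_le1.
Qed.

Lemma integral_tev_Re (m : {finite_measure set (torus R d) -> \bar R}) w :
  \int[m]_z complex.Re (tev w z) =
  \sum_(p <- w) p.1 * \int[m]_z complex.Re (torus_char p.2 z).
Proof.
have iT (p : R * 'rV[int]_d) : m.-integrable setT
    (EFin \o (fun z => complex.Re (torus_char p.2 z))).
  apply: (bounded_integrable m _ (torus_char_Re_le1 p.2)).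
  exact: (cmeasurable_torus_char R p.2).1.
rewrite (eq_Rintegral _ (fun z _ => tev_Re w z)) Rintegral_sum.
  by apply: eq_bigr => p _; rewrite RintegralZl.
by move=> p; exact: (integrableZl measurableT p.1 (iT p)).
Qed.

Lemma lebesgue_tev_Re w :
  \int[torus_lebesgue R d]_z complex.Re (tev w z) =
  \sum_(p <- w) p.1 * (p.2 == 0)%:R.
Proof.
rewrite integral_tev_Re; apply: eq_bigr => p _; congr (_ * _).
have [->|p0] := eqVneq p.2 0; last by have [] := torus_char_integral R p0.
rewrite (@eq_Rintegral _ _ _ _ _ (fun=> 1)).
  rewrite Rintegral_cst// mul1r.
  exact: (congr1 fine (probability_setT (torus_lebesgue R d))).
by move=> z _; rewrite torus_char0.
Qed.

(** * Polynomials in the shift *)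

Section spectral.
Variables (A : pointedType) (mu : probability (config d A) R).
Hypothesis mu_inv : invariant_measure mu.
Local Notation shift := Defs.shift.

Definition tshift w (F : config d A -> R) x : R := \sum_(p <- w) p.1 * F (shift p.2 x).

Lemma square_int_tshift w F : square_int mu F -> square_int mu (tshift w F).
Proof.
move=> hF; apply: square_int_sum => p; apply: square_intZ.
exact: square_int_shift.
Qed.

Lemma tshift_mul w v F : tshift (tmul w v) F = tshift w (tshift v F).
Proof.
apply/funext => x; rewrite /tshift big_allpairs_dep; apply: eq_bigr => a _.
by rewrite mulr_sumr; apply: eq_bigr => b _; rewrite shift_shift mulrA [a.2 + _]addrC.
Qed.

Lemma ip_tshiftE w F : square_int mu F -> ip mu (tshift w F) (tshift w F) =
  \sum_(a <- w) \sum_(b <- w) a.1 * b.1 *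
    ip mu (fun x => F (shift (a.2 - b.2) x)) F.
Proof.
move=> hF; have hs k := square_int_shift mu_inv k hF.
have hz (a : R * 'rV[int]_d) := square_intZ a.1 (hs a.2).
rewrite (ip_suml _ hz (square_int_tshift w hF)); apply: eq_bigr => a _.
rewrite ipC (ip_suml _ hz (hz a)); apply: eq_bigr => b _.
rewrite (ipZl _ (hs _) (hz _)) ipC (ipZl _ (hs _) (hs _)) mulrA [b.1 * _]mulrC.
congr (_ * _); rewrite -(ip_shift mu_inv b.2 (hs _) hF) /ip.
by apply: eq_Rintegral => x _; rewrite shift_shift subrK.
Qed.

Lemma square_integrable_parts f : square_integrable mu f ->
  square_int mu (fun x => complex.Re (f x)) /\ square_int mu (fun x => complex.Im (f x)).
Proof.
move=> [mr mi fi].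
have iS : mu.-integrable setT
    (EFin \o (fun x => complex.Re (f x) ^+ 2 + complex.Im (f x) ^+ 2)).
  apply/integrableP; split.
    by apply/measurable_EFinP; apply: measurable_funD; exact: measurable_funX.
  apply: le_lt_trans fi; rewrite le_eqVlt; apply/orP; left; apply/eqP.
  by apply: eq_integral => x _ /=; rewrite ger0_norm// addr_ge0 ?sqr_ge0.
split; split => //; apply: (integrable_le _ _ iS); do ?exact: measurable_funX.
  by move=> x; rewrite ger0_norm ?sqr_ge0// lerDl sqr_ge0.
by move=> x; rewrite ger0_norm ?sqr_ge0// lerDr sqr_ge0.
Qed.

(** The coefficients of [w] are real, so only real parts of correlations of f enter, and these are
    the sums of the correlations of its real and imaginary parts. Real-valued L^2 functions
    therefore suffice. *)
Lemma integral_tsqr f (s : {finite_measure set (torus R d) -> \bar R}) w :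
  square_integrable mu f -> spectral_measure mu f s ->
  \int[s]_z tsqr w z =
  ip mu (tshift w (fun x => complex.Re (f x))) (tshift w (fun x => complex.Re (f x))) +
  ip mu (tshift w (fun x => complex.Im (f x))) (tshift w (fun x => complex.Im (f x))).
Proof.
move=> /square_integrable_parts[hr hi] sf.
rewrite !ip_tshiftE// -big_split/=.
under [RHS]eq_bigr do rewrite -big_split/=.
under eq_Rintegral do rewrite tsqrE.
rewrite integral_tev_Re big_allpairs_dep; apply: eq_bigr => a _.
rewrite big_map; apply: eq_bigr => b _ /=; rewrite -mulrDr; congr (_ * _).
have := congr1 (@complex.Re R) (sf (b.2 - a.2)); rewrite /cintegral /= opprB => ->.
have hsr := square_int_shift mu_inv (a.2 - b.2) hr.
have hsi := square_int_shift mu_inv (a.2 - b.2) hi.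
rewrite /ip -(RintegralD measurableT (square_int_mul hsr hr) (square_int_mul hsi hi)).
apply: eq_Rintegral => x _.
by case: (f x) => p q; case: (f (shift _ x)) => p' q' /=; rewrite mulrN opprK.
Qed.

End spectral.

End trigpoly.

(** * Mutual singularity *)

Section singular.
Context d (T : measurableType d) (R : realType).

Lemma fine_measure_le (m : {finite_measure set T -> \bar R}) (B : set T)
    (f : T -> R) (C : R) : measurable B -> measurable_fun setT f ->
  (forall x, 0 <= f x <= C) -> (forall x, B x -> 1 <= f x) ->
  (m B <= (\int[m]_x f x)%:E)%E.
Proof.
move=> mB mf f0C fB.
have i_f : m.-integrable setT (EFin \o f).
  by apply: (@bounded_integrable R _ _ m f C mf) => x; have /andP[h1 h2] := f0C x; rewrite ger0_norm.
rewrite -(fineK (fin_num_measure m _ mB)) lee_fin.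
have -> : fine (m B) = \int[m]_x (\1_B x : R) by rewrite /Rintegral integral_indic// setIT.
apply: le_Rintegral => //; first exact: integrable_indic.
move=> x _; have [xB|xB] := pselect (B x); first by rewrite indicE mem_set// fB.
by rewrite indicE memNset//; have /andP[] := f0C x.
Qed.

(** Borel-Cantelli: with summable tolerances and A_k the set where u_k >= 1/2, Chebyshev makes the
    measures m(A_k) summable and n(~A_k) tend to 0. The upper limit of the A_k is then null for m
    and its complement null for n. *)
Lemma mutually_singular_approx (m n : {finite_measure set T -> \bar R}) :
  (forall e : R, 0 < e -> exists u : T -> R, [/\ measurable_fun setT u,
    forall x, 0 <= u x <= 1, \int[m]_x (u x ^+ 2) <= e & \int[n]_x (1 - u x) <= e]) ->
  mutually_singular m n.
Proof.
move=> H; pose e k : R := 1 / (2 ^ (k + 1))%:R.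
have e0 k : 0 < e k by rewrite divr_gt0// ltr0n expn_gt0.
have e40 k : 0 < e k / 4 by rewrite divr_gt0.
pose u k := sval (cid (H _ (e40 k))); pose A k := [set x | 1 / 2 <= u k x].
have mu_ k : measurable_fun setT (u k) by case: (svalP (cid (H _ (e40 k)))).
have u01 k x : 0 <= u k x <= 1 by have [_ + _ _] := svalP (cid (H _ (e40 k))); apply.
have um k : \int[m]_x (u k x ^+ 2) <= e k / 4 by case: (svalP (cid (H _ (e40 k)))).
have un k : \int[n]_x (1 - u k x) <= e k / 4 by case: (svalP (cid (H _ (e40 k)))).
have mA k : measurable (A k).
  rewrite (_ : A k = u k @^-1` `[1 / 2, +oo[); first by rewrite -[X in measurable X]setTI; exact: mu_.
  by apply/seteqP; split => x; rewrite /A /preimage /= in_itv /= andbT.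
have Am k : (m (A k) <= (e k)%:E)%E.
  apply: le_trans (@fine_measure_le m (A k) (fun x => 4 * u k x ^+ 2) 4 _ _ _ _) _ => //.
  - by apply: measurable_funM => //; exact: measurable_funX.
  - move=> x; have /andP[h1 h2] := u01 k x; apply/andP; split; nra.
  - by move=> x; rewrite /A /= => h; nra.
  - rewrite lee_fin RintegralZl//; first by have := um k; lra.
    apply: (@bounded_integrable _ _ _ _ _ 1); first exact: measurable_funX.
    by move=> x; have /andP[h1 h2] := u01 k x; rewrite ger0_norm ?sqr_ge0// expr_le1.
have An k : (n (~` A k) <= (e k)%:E)%E.
  apply: le_trans (@fine_measure_le n (~` A k) (fun x => 2 * (1 - u k x)) 2 _ _ _ _) _.
  - exact: measurableC.
  - by apply: measurable_funM => //; exact: measurable_funB.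
  - by move=> x; have /andP[h1 h2] := u01 k x; apply/andP; split; lra.
  - by move=> x; rewrite /A /= => /negP; rewrite -ltNge; lra.
  - rewrite lee_fin RintegralZl//; first by have := un k; have := e0 k; lra.
    apply: (@bounded_integrable _ _ _ _ _ 1); first exact: measurable_funB.
    by move=> x; have /andP[h1 h2] := u01 k x; rewrite ger0_norm; lra.
exists (lim_sup_set A); split.
- by apply: bigcapT_measurable => i; apply: bigcup_measurable.
- apply: lim_sup_set_cvg0 => //.
  apply: (@le_lt_trans _ _ (\sum_(k <oo) (e k)%:E)%E); first by apply: lee_nneseries => [k _ _|k _]; [exact: measure_ge0|exact: Am].
  by rewrite (cvg_lim _ (@cvg_geometric_eseries_half R 1 0))// ltry.
rewrite /lim_sup_set setC_bigcap; apply: measure_negligible.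
  apply: bigcupT_measurable => i; apply: measurableC; exact: bigcup_measurable.
apply: negligible_bigcup => i.
have mi : measurable (~` (\bigcup_(j >= i) A j)).
  by apply: measurableC; exact: bigcup_measurable.
apply/negligibleP => //; apply/eqP; rewrite eq_le measure_ge0 andbT.
apply/lee_addgt0Pr => x x0; rewrite add0e.
have [k0 ke] := exists_div_pow2_le 1 x0.
pose k := maxn i k0.
apply: (@le_trans _ _ (n (~` A k))).
  apply: le_measure; rewrite ?inE//; first exact: measurableC.
  by apply: subsetC => y Ay; exists k => //=; exact: leq_maxl.
apply: le_trans (An k) _; rewrite lee_fin; apply: le_trans ke.
rewrite /e natrX ler_pM2l// lef_pV2 ?posrE ?exprn_gt0// ler_weXn2l ?ler1n//.
by rewrite addn1 leqW// leq_maxr.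
Qed.

Lemma mutually_singular_sum n (t : 'I_n -> {finite_measure set T -> \bar R})
    (s : {finite_measure set T -> \bar R}) (m : {finite_measure set T -> \bar R}) :
  (forall i, mutually_singular (t i) m) ->
  s `<< (fun B => \sum_(i < n) t i B)%E -> mutually_singular s m.
Proof.
move=> H sdom; pose N i := sval (cid (H i)).
have NP i : [/\ measurable (N i), t i (N i) = 0%E & m (~` (N i)) = 0%E] by exact: (svalP (cid (H i))).
pose M k := if insub k is Some i then N i else setT.
have mM k : measurable (M k) by rewrite /M; case: insubP => // i _ _; case: (NP i).
have M0 : m.-negligible (\bigcup_k ~` M k).
  apply: negligible_bigcup => k; apply/negligibleP; first exact: measurableC.
  rewrite /M; case: insubP => [i _ _|_]; first by case: (NP i).
  by rewrite setCT measure0.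
exists (\bigcap_k M k); split.
- exact: bigcapT_measurable.
- have /(_ (\bigcap_k M k)) := sdom; apply => //; last exact: bigcapT_measurable.
  move=> B mB BM; rewrite big1// => i _; apply/eqP; rewrite eq_le measure_ge0 andbT.
  have [mN tN _] := NP i; rewrite -tN; apply: le_measure; rewrite ?inE//.
  by move=> x /BM /(_ (val i) I); rewrite /M valK.
- rewrite setC_bigcap; apply: measure_negligible M0.
  by apply: bigcupT_measurable => k; exact: measurableC.
Qed.

Lemma mutually_singular_dominated (s t m : {finite_measure set T -> \bar R}) :
  mutually_singular t m -> s `<< t -> mutually_singular s m.
Proof.
move=> [N [mN tN mN']] st; exists N; split => //.
by have /null_content_dominatesP := st; apply.
Qed.

End singular.

(** * Contraction of the spectral mass *)

Section purely_singular.
Variables (R : realType) (d : nat) (A : pointedType).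
Variables (q : 'rV[int]_d) (S : substitution d A).
Hypothesis q_ge2 : forall i, 2 <= q 0 i.
Hypothesis d_gt0 : (0 < d)%N.
Hypothesis A_finite : finite_set [set: A].
Hypothesis S_bij : bijective_subst q S.
Hypothesis S_comm : commutative_subst q S.

Local Notation digits := (digits q_ge2).
Local Notation Q := ((size digits)%:R : R).
Implicit Types (r k m : 'rV[int]_d) (z : torus R d).

Lemma scale_exp_inj m : m != 0 -> injective (fun n => scale q n m).
Proof.
move=> m0 n n' /rowP e.
have [i mi] : exists i, m 0 i != 0.
  apply: contrapT => nex; case/eqP: m0; apply/rowP => i; rewrite mxE.
  by apply/eqP; apply: contrapT => /negP h; apply: nex; exists i.
have := e i; rewrite !mxE => /(mulfI mi) e'.
have := q_ge2 i => qi; apply: (ieexprIn _ _ e'); lia.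
Qed.

(** Distinct frequencies make the Lebesgue mean of |p_r|^2 equal to 1/N, while the energy inequality
    keeps the mass seen by the spectral measure bounded below: this contrast produces
    singularity. *)
Lemma carry_freq_inj r : r \in digits -> injective (carry_freq q r).
Proof.
move=> /digitsP br n n'; rewrite /carry_freq; case: eqVneq => [_|r0].
  apply: scale_exp_inj; apply/negP => /eqP/rowP/(_ (Ordinal d_gt0)).
  by rewrite !mxE; have := q_ge2 (Ordinal d_gt0); lia.
by move=> /(scale_exp_inj (quo_qmax_neq0 q_ge2 br r0)) [].
Qed.

Definition pavg n0 N r : tpoly R d :=
  [seq (N%:R^-1, scale q n0 (carry_freq q r n)) | n <- index_iota N (N + N)].

Lemma tshift_pavg n0 N r (F : config d A -> R) :
  tshift (pavg n0 N r) F = shift_avg q n0 N r F.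
Proof. by apply/funext => x; rewrite /tshift big_map /shift_avg mulr_sumr. Qed.

Lemma tsqr_pavg_le1 n0 N r z : (0 < N)%N -> tsqr (pavg n0 N r) z <= 1.
Proof.
move=> N0; have N0' : N%:R != 0 :> R by rewrite pnatr_eq0 -lt0n.
rewrite tsqrE; apply: le_trans (ler_norm _) _; apply: le_trans (tev_Re_le _ _) _.
rewrite big_allpairs_dep big_map (eq_bigr (fun=> N%:R^-1)).
  by rewrite sumr_const_nat addnK -[N%:R^-1 *+ N]mulr_natl divff.
move=> n _; rewrite big_map big_map /= (eq_bigr (fun=> N%:R^-1 * N%:R^-1)).
  by rewrite sumr_const_nat addnK -[(_ / _) *+ N]mulr_natl mulVKf.
by move=> p _ /=; rewrite ger0_norm// mulr_ge0// invr_ge0.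
Qed.

Lemma lebesgue_tsqr_pavg n0 N r : (0 < N)%N -> r \in digits ->
  \int[torus_lebesgue R d]_z tsqr (pavg n0 N r) z = N%:R^-1.
Proof.
move=> N0 rD; have N0' : N%:R != 0 :> R by rewrite pnatr_eq0 -lt0n.
under eq_Rintegral do rewrite tsqrE.
rewrite lebesgue_tev_Re big_allpairs_dep big_map.
rewrite big_nat (eq_bigr (fun=> N%:R^-1 * N%:R^-1)) -?big_nat.
  by rewrite sumr_const_nat addnK -[(_ / _) *+ N]mulr_natl mulVKf.
move=> n nN; rewrite big_map big_map /=.
rewrite (bigD1_seq n) ?mem_index_iota ?iota_uniq//= subrr eqxx mulr1 big1 ?addr0//.
move=> p pn; rewrite subr_eq0 (inj_eq (@scale_inj _ _ q_ge2 n0)).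
by rewrite (inj_eq (carry_freq_inj rD)) eq_sym (negPf pn) mulr0.
Qed.

Definition hval n0 N z : R := \sum_(r <- digits) tsqr (pavg n0 N r) z.

Definition hpoly n0 N : tpoly R d :=
  flatten [seq tmul (pavg n0 N r) (tstar (pavg n0 N r)) | r <- digits].

Lemma tev_hpoly n0 N z : tev (hpoly n0 N) z = Complex (hval n0 N z) 0.
Proof.
rewrite /hpoly /hval; elim: digits => [|r s IH].
  by rewrite /= /tev !big_nil.
rewrite /= tev_cat IH tev_mul_star big_cons.
by apply/eqP; rewrite eq_complex /= addr0 !eqxx.
Qed.

Lemma hval_bounds n0 N z : (0 < N)%N -> 0 <= hval n0 N z <= Q.
Proof.
move=> N0; rewrite sumr_ge0/=; last by move=> r _; exact: tsqr_ge0.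
rewrite -[Q]mulr1 mulr_natl -iter_addr_0 -(count_predT digits) -big_const_seq.
by apply: ler_sum => r _; exact: tsqr_pavg_le1.
Qed.

Definition vpoly n0 N : tpoly R d :=
  (1, 0) :: [seq (- Q^-1 * p.1, p.2) | p <- hpoly n0 N].

Lemma tev_vpoly n0 N z : tev (vpoly n0 N) z = Complex (1 - Q^-1 * hval n0 N z) 0.
Proof.
have E : tev [seq (- Q^-1 * p.1, p.2) | p <- hpoly n0 N] z =
    Complex (- Q^-1) 0 * tev (hpoly n0 N) z.
  rewrite /tev big_map mulr_sumr; apply: eq_bigr => p _; rewrite mulrA; congr (_ * _).
  by apply/eqP; rewrite eq_complex /= !mul0r !mulr0 subr0 addr0 !eqxx.
rewrite /vpoly /tev big_cons -/(tev _ z) E tev_hpoly torus_char0 mulr1.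
by apply/eqP; rewrite eq_complex /= !mul0r !mulr0 subr0 !addr0 mulNr !eqxx.
Qed.

Section one_measure.
Variables (mu : probability (config d A) R) (f : config d A -> R[i]).
Variable s : {finite_measure set (torus R d) -> \bar R}.
Hypothesis mu_inv : invariant_measure mu.
Hypothesis mu_S : mu (subst_shift q S) = 1%E.
Hypothesis f_sq : square_integrable mu f.
Hypothesis s_f : spectral_measure mu f s.

Local Notation leb := (torus_lebesgue R d).

Definition re_tev (w : tpoly R d) z : R := complex.Re (tev w z).

Definition good_poly (w : tpoly R d) :=
  forall z, tev w z = Complex (re_tev w z) 0 /\ 0 <= re_tev w z <= 1.

Lemma good_tsqr w z : good_poly w -> tsqr w z = re_tev w z ^+ 2.
Proof. by move=> gw; rewrite /tsqr (gw z).1 /= expr0n addr0. Qed.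

Lemma integrable_re_tev (m : {finite_measure set (torus R d) -> \bar R}) w :
  m.-integrable setT (EFin \o re_tev w).
Proof. exact: (bounded_integrable m (measurable_tev_Re w) (tev_Re_le w)). Qed.

Lemma integrable_tsqr (m : {finite_measure set (torus R d) -> \bar R}) w :
  m.-integrable setT (EFin \o tsqr w).
Proof.
rewrite (_ : tsqr w = re_tev (tmul w (tstar w))); first exact: integrable_re_tev.
by apply/funext => z; rewrite tsqrE.
Qed.

Lemma integrable_re_tev2 (m : {finite_measure set (torus R d) -> \bar R}) w :
  good_poly w -> m.-integrable setT (EFin \o (fun z => re_tev w z ^+ 2)).
Proof.
move=> gw; rewrite (_ : _ \o _ = EFin \o tsqr w); first exact: integrable_tsqr.
by apply/funext => z; rewrite /= good_tsqr.
Qed.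

Lemma energy_spectral w e : 0 < e ->
  exists n1 K1, forall n0 K, (n1 <= n0)%N -> (K1 <= K)%N -> (0 < K)%N ->
    \int[s]_z tsqr w z <= 12 * Q ^+ 2 * \sum_(r <- digits)
      \int[s]_z tsqr (tmul (pavg n0 (K ^ 2) r) w) z + e.
Proof.
move=> e0; have e2 : 0 < e / 2 by lra.
have [hr hi] := square_integrable_parts f_sq.
have hwr := square_int_tshift mu_inv w hr; have hwi := square_int_tshift mu_inv w hi.
have [n1 [K1 H1]] := energy_L2 mu_inv q_ge2 d_gt0 A_finite S_bij S_comm mu_S e2 hwr.
have [n2 [K2 H2]] := energy_L2 mu_inv q_ge2 d_gt0 A_finite S_bij S_comm mu_S e2 hwi.
exists (maxn n1 n2), (maxn K1 K2) => n0 K; rewrite !geq_max.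
move=> /andP[n10 n20] /andP[K1K K2K] K0.
have := H1 n0 K n10 K1K K0; have := H2 n0 K n20 K2K K0.
under [X in _ -> _ -> _ <= _ * X + _]eq_bigr do rewrite (integral_tsqr mu_inv _ f_sq s_f) !tshift_mul !tshift_pavg.
rewrite (integral_tsqr mu_inv _ f_sq s_f) big_split/= mulrDr; lra.
Qed.

Lemma energy_good w e : 0 < e -> good_poly w ->
  exists n1 K1, forall n0 K, (n1 <= n0)%N -> (K1 <= K)%N -> (0 < K)%N ->
    \int[s]_z (re_tev w z ^+ 2) <=
    12 * Q ^+ 2 * \int[s]_z (hval n0 (K ^ 2) z * re_tev w z ^+ 2) + e.
Proof.
move=> e0 gw; have [n1 [K1 H]] := energy_spectral w e0.
exists n1, K1 => n0 K n10 K1K K0; have := H n0 K n10 K1K K0.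
under eq_Rintegral do rewrite good_tsqr//.
rewrite -(Rintegral_sum _ (fun r => integrable_tsqr s _)).
rewrite [X in _ <= _ * X + _](_ : _ = \int[s]_z (hval n0 (K ^ 2) z * re_tev w z ^+ 2))//.
apply: eq_Rintegral => z _; rewrite /hval mulr_suml.
apply: eq_bigr => r _.
by rewrite tsqr_mul (good_tsqr _ gw).
Qed.

(** Here E is the integral of w^2, X is 12 Q^2 times that of h w^2, and c = 1 / (12 Q^3), so that c
    X is the integral of (h / Q) w^2. The hypothesis on X turns E - c X into (1 - c) E up to a small
    error. *)
Lemma energy_step (c E X M dl : R) : 0 < c <= 1 -> 0 < dl ->
  E <= X + dl / 4 -> E <= M + dl / 4 -> E - c * X <= (1 - c) * M + dl.
Proof. by move=> /andP[c0 c1] dl0 EX EM; nra. Qed.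

Lemma contraction_bounds : 0 <= 1 - (12 * Q ^+ 3)^-1 < 1.
Proof.
have Q3 : 1 <= Q ^+ 3 by rewrite exprn_ege1// Q_ge1.
have p : 0 < 12 * Q ^+ 3 by lra.
by rewrite subr_ge0 invf_le1// gtrBl invr_gt0 p andbT; lra.
Qed.

(** The tolerance stays general in the induction: each step spends a quarter of it on the previous
    polynomial, on the energy inequality, and on 1/N. *)
Lemma small_poly (k : nat) (dl : R) : 0 < dl -> exists w, [/\ good_poly w,
  \int[s]_z (re_tev w z ^+ 2) <= (1 - (12 * Q ^+ 3)^-1) ^+ k * fine (s setT) + dl &
  \int[leb]_z (1 - re_tev w z) <= dl].
Proof.
have Q1 : 1 <= Q by exact: Q_ge1.
set c := (12 * Q ^+ 3)^-1.
have c01 : 0 < c <= 1 by have /andP[] := contraction_bounds; rewrite -/c; lra.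
elim: k dl => [|k IH] dl dl0.
  pose w : tpoly R d := [:: (1, 0)].
  have wE z : tev w z = 1 by rewrite /tev big_seq1 torus_char0 mulr1.
  have rE z : re_tev w z = 1 by rewrite /re_tev wE.
  exists w; split.
  - by move=> z; rewrite rE wE lexx ler01.
  - rewrite (@eq_Rintegral _ _ _ _ _ (fun=> 1)); last by move=> z _; rewrite rE expr1n.
    by rewrite Rintegral_cst// expr0 lerDl ltW.
  - rewrite (@eq_Rintegral _ _ _ _ _ (fun=> 0)); last by move=> z _; rewrite rE subrr.
    by rewrite Rintegral_cst// mul0r ltW.
have dl4 : 0 < dl / 4 by lra.
have [w [gw ws wl]] := IH _ dl4.
have [n1 [K1 H]] := energy_good dl4 gw.
pose K := (maxn K1 (Num.bound (dl / 4)^-1).+1)%N.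
have K0 : (0 < K)%N by rewrite leq_max orbT.
have := H n1 K (leqnn _) (leq_maxl _ _) K0; set N := (K ^ 2)%N => HN.
have N0 : (0 < N)%N by rewrite expn_gt0 K0.
have Ndl : N%:R^-1 <= dl / 4.
  rewrite -[leRHS]invrK lef_pV2 ?posrE ?invr_gt0 ?ltr0n//.
  apply: le_trans (ltW (archi_boundP _)) _; first by rewrite invr_ge0 ltW.
  by rewrite ler_nat (leq_trans _ (leq_pmull K K0))// (leq_trans (leqnSn _))// leq_maxr.
pose h := hval n1 N; have hb z : 0 <= h z <= Q by exact: hval_bounds.
have Q0 : 0 < Q by lra.
have g01 z : 0 <= 1 - Q^-1 * h z <= 1.
  have /andP[h0 hQ] := hb z; rewrite subr_ge0 mulrC ler_pdivrMr// mul1r hQ /=.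
  by rewrite lerBlDr lerDl mulr_ge0// invr_ge0 ltW.
pose w' := tmul (vpoly n1 N) w; exists w'.
have wE z : tev w' z = Complex ((1 - Q^-1 * h z) * re_tev w z) 0.
  rewrite tev_mul tev_vpoly (gw z).1.
  by apply/eqP; rewrite eq_complex /= !mul0r !mulr0 subr0 addr0 !eqxx.
have rE z : re_tev w' z = (1 - Q^-1 * h z) * re_tev w z by rewrite /re_tev wE.
have gw' : good_poly w'.
  move=> z; rewrite rE wE; split => //; have /andP[a0 a1] := g01 z.
  by have /andP[b0 b1] := (gw z).2; rewrite mulr_ge0//= mulr_ile1.
have ih (m : {finite_measure set (torus R d) -> \bar R}) : m.-integrable setT (EFin \o h).
  rewrite (_ : h = re_tev (hpoly n1 N)); first exact: integrable_re_tev.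
  by apply/funext => z; rewrite /re_tev tev_hpoly.
have mh : measurable_fun setT h by move/integrableP: (ih s) => [/measurable_EFinP].
have mw : measurable_fun setT (re_tev w) := measurable_tev_Re w.
split => //.
- have i2 := integrable_re_tev2 s gw.
  have ih2 : s.-integrable setT (EFin \o (fun z => h z * re_tev w z ^+ 2)).
    apply: (integrable_le _ _ (ih s)); first by apply: measurable_funM => //; exact: measurable_funX.
    move=> z; have /andP[h0 _] := hb z; have /andP[b0 b1] := (gw z).2.
    by rewrite ger0_norm ?mulr_ge0 ?sqr_ge0// ler_piMr// expr_le1.
  (* From (1 - a)^2 <= 1 - a for a = h / Q in [0, 1]. *)
  have le1 : \int[s]_z (re_tev w' z ^+ 2) <=
      \int[s]_z (re_tev w z ^+ 2) - Q^-1 * \int[s]_z (h z * re_tev w z ^+ 2).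
    have iQ := integrableZl measurableT Q^-1 ih2.
    rewrite -(RintegralZl Q^-1 measurableT ih2) -(RintegralB measurableT i2 iQ).
    apply: le_Rintegral => //; first exact: integrable_re_tev2.
      exact: (integrableB measurableT i2 iQ).
    move=> z _; rewrite rE exprMn; have /andP[a0 a1] := g01 z.
    have b0 := sqr_ge0 (re_tev w z); move: a0 a1 b0; rewrite [Q^-1 * (_ * _)]mulrA.
    move: (Q^-1 * h z) (re_tev w z ^+ 2) => a b a0 a1 b0.
    rewrite -subr_ge0 (_ : _ - _ = a * (1 - a) * b); last by ring.
    by rewrite !mulr_ge0//; lra.
  have cX : Q^-1 * \int[s]_z (h z * re_tev w z ^+ 2) =
      c * (12 * Q ^+ 2 * \int[s]_z (h z * re_tev w z ^+ 2)).
    by rewrite mulrA; congr (_ * _); rewrite /c; field; rewrite gt_eqF.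
  rewrite exprS -mulrA; apply: le_trans le1 _; rewrite cX.
  exact: energy_step c01 dl0 HN ws.
- have i0 : leb.-integrable setT (EFin \o (fun=> 1)) by exact: finite_measure_integrable_cst.
  have il := integrable_re_tev leb w.
  have i1 : leb.-integrable setT (EFin \o (fun z => 1 - re_tev w z)).
    exact: (integrableB measurableT i0 il).
  have iQ := integrableZl measurableT Q^-1 (ih leb).
  have hN : \int[leb]_z h z = Q * N%:R^-1.
    rewrite (Rintegral_sum _ (fun r => integrable_tsqr leb _)).
    rewrite big_seq (eq_bigr (fun=> N%:R^-1)) -?big_seq.
      by rewrite big_const_seq count_predT iter_addr_0 mulr_natl.
    by move=> r rD; exact: lebesgue_tsqr_pavg.
  (* From 1 - (1 - a) b <= (1 - b) + a, valid for a >= 0 and b <= 1; the Lebesgue integral of a = h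
     / Q is 1/N. *)
  apply: (@le_trans _ _ (\int[leb]_z ((1 - re_tev w z) + Q^-1 * h z))).
    apply: le_Rintegral => //.
    - exact: (integrableB measurableT i0 (integrable_re_tev leb w')).
    - exact: (integrableD measurableT i1 iQ).
    move=> z _; rewrite rE; have /andP[a0 a1] := g01 z; have /andP[b0 b1] := (gw z).2.
    by move: a0 a1 b0 b1; move: (Q^-1 * h z) (re_tev w z) => a b; nra.
  rewrite (RintegralD measurableT i1 iQ) (RintegralZl _ measurableT (ih leb)) hN.
  by rewrite mulKf ?gt_eqF//; move: wl Ndl dl0; move: (\int[_]_z _) (N%:R^-1) => x y; lra.
Qed.

Lemma spectral_measure_singular : mutually_singular s leb.
Proof.
apply: mutually_singular_approx => e e0; have e2 : 0 < e / 2 by lra.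
have c01 := contraction_bounds.
set a := 1 - (12 * Q ^+ 3)^-1 in c01.
pose M := fine (s setT); have M0 : 0 <= M by exact: fine_ge0.
have [k ak] : exists k : nat, a ^+ k * M <= e / 2.
  have : `|a| < 1 by case/andP: c01 => ? ?; rewrite ger0_norm.
  (* Dividing by M + 1 instead of M covers the case of a null spectral measure. *)
  move=> /cvg_expr/cvgrPdist_le/(_ (e / 2 / (M + 1))) [|k _ /(_ k (leqnn k))].
    by rewrite divr_gt0//; lra.
  rewrite sub0r normrN => h; exists k.
  have M1 : 0 < M + 1 by lra.
  move: h; rewrite ler_pdivlMr//; have := ler_norm (a ^+ k); have := normr_ge0 (a ^+ k).
  by move: M0 {M1}; move: (a ^+ k) M (`|_|) => x y z; nra.
have [w [gw ws wl]] := small_poly k e2.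
exists (re_tev w); split.
- exact: measurable_tev_Re.
- by move=> z; exact: (gw z).2.
- by apply: le_trans ws _; rewrite -/a -/M; lra.
- by apply: le_trans wl _; lra.
Qed.

End one_measure.

End purely_singular.

Theorem theorem3p19 (R : realType) (d : nat) (A : pointedType)
    (q : 'rV[int]_d) (S : substitution d A)
    (d_ge1 : (1 <= d)%N)
    (A_finite : finite_set [set: A])
    (A_two : exists a b : A, a <> b)
    (q_ge2 : forall i, 2 <= q 0 i)
    (S_aperiodic : aperiodic q S)
    (S_bijective : bijective_subst q S)
    (S_commutative : commutative_subst q S) :
  purely_singular R q S.
Proof.
move=> s [n [mu [t [mu_erg _ _ t_max [s_t _]]]]].
apply: (mutually_singular_sum _ s_t) => i.
have [[mu_inv _] mu_S] := mu_erg i.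
have [F [sF [F_sq F_sF _ [t_sF _]]]] := t_max i.
apply: mutually_singular_dominated t_sF.
exact: (spectral_measure_singular q_ge2 d_ge1 A_finite S_bijective S_commutative mu_inv mu_S F_sq F_sF).
Qed.
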